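(* In the regression model $Y_i=f(x_i^{(n)})+\varepsilon_i$, $1\le i\le n$, with B-spline regressors, assume that $f$ is bounded and that there exist positive constants $C_1,C_2$ such that, as $n$ increases, for any $\theta\in\mathbb{R}^{k_n}$, $$C_1\frac n{k_n}\|\theta\|^2\le\theta^T\Phi^T\Phi\,\theta\le C_2\frac n{k_n}\|\theta\|^2 .$$ Let $\widetilde W=\mathcal{N}(0,\tau_n^2I_{k_n})$ be the prior on the spline coefficients $\theta\in\mathbb{R}^{k_n}$, with the sequence $\tau_n>0$ satisfying $$\frac{k_n^2\ln n}{n}=o(\tau_n^2)\quad\text{and}\quad\frac{k_n^3\ln n}{n}=o(\tau_n^4).$$ Then $$E\left\|\widetilde W(d\theta\mid Y)-\mathcal{N}\left(\theta_Y,\sigma^2(\Phi^T\Phi)^{-1}\right)\right\|_{\mathrm{TV}}\longrightarrow0\qquad\text{as }n\to\infty,$$ and the convergence rate relative to the Euclidean norm for $\theta$ is $\frac{k_n}{\sqrt n}$: for every sequence $\lambda_n\to\infty$, $$E\left[\widetilde W\left(\|\theta-\theta_0\|\ge\lambda_n\frac{k_n}{\sqrt n}\ \Big|\ Y\right)\right]\longrightarrow0 .$$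
   Context: Model: $\alpha>0$ and $f\in C^\alpha[0,1]$ is a fixed function (i.e. $f$ is $\alpha_0$ times continuously differentiable, $\alpha_0$ the greatest integer less than $\alpha$, with $\sup_{x\ne x'}|f^{(\alpha_0)}(x)-f^{(\alpha_0)}(x')|/|x-x'|^{\alpha-\alpha_0}<\infty$). For a (not necessarily uniform) design $(x_i^{(n)})_{n\ge1,1\le i\le n}$ in $[0,1]$, one observes $Y=(Y_1,\dots,Y_n)$, $Y_i=f(x_i^{(n)})+\varepsilon_i$, with $\varepsilon_i$ i.i.d. $\mathcal{N}(0,\sigma^2)$, $\sigma>0$ known and not depending on $n$. $F_0=(f(x_i^{(n)}))_{1\le i\le n}$; $E$ is expectation under $Y\sim\mathcal{N}(F_0,\sigma^2I_n)$. Regressors: fix an integer $q\ge\alpha$ and let $K=k_n+1-q\ge1$. Partition $(0,1]$ into the $K$ intervals $((j-1)/K,j/K]$, $1\le j\le K$. $(B_j)_{1\le j\le k_n}$ is the usual (normalized, partition of unity) B-spline basis of the $k_n$-dimensional space of splines of order $q$ on this partition, i.e. functions that are polynomials of degree at most $q-1$ on each interval and (if $q\ge2$) $q-2$ times continuously differentiable. $\Phi$ is the $n\times k_n$ matrix with columns $\phi_j=(B_j(x_i^{(n)}))_{1\le i\le n}$, of rank $k_n\le n$. $\theta_Y=(\Phi^T\Phi)^{-1}\Phi^TY$, $\theta_0=(\Phi^T\Phi)^{-1}\Phi^TF_0$. $\widetilde W(\cdot\mid Y)$ is the posterior distribution of $\theta$ when $\theta\sim\widetilde W$ and, conditionally on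 $\theta$, $Y\sim\mathcal{N}(\Phi\theta,\sigma^2I_n)$. $\|\cdot\|$ is the Euclidean norm; $\|Q-Q'\|_{\mathrm{TV}}=\sup_A|Q(A)-Q'(A)|$. *)

(* Defs.v *)
From HB Require Import structures.
From mathcomp Require Import all_boot all_order all_algebra.
From mathcomp Require Import all_classical all_reals all_analysis.
From mathcomp Require Import measurable_realfun.

Set Implicit Arguments.
Unset Strict Implicit.
Unset Printing Implicit Defensive.

Import Order.TTheory GRing.Theory Num.Theory.
Import numFieldNormedType.Exports.

Local Open Scope classical_set_scope.
Local Open Scope ring_scope.

Section Holder.
Context {R : realType}.

(* One-sided at the endpoints; only the values on [0, 1] matter. *)
Definition derivative_on01 (g h : R -> R) : Prop :=
  forall x, x \in `[0, 1] ->
    (fun y => (g y - g x) / (y - x)) @ within `[0, 1] x^' --> h x.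

(* m is the greatest integer (strictly) less than a, and d j is the j-th
   derivative of f. *)
Definition holder_class (a : R) (f : R -> R) : Prop :=
  exists m : nat, exists d : nat -> R -> R,
  [/\ m%:R < a <= m.+1%:R,
      {in `[0, 1], d 0%N =1 f},
      (forall j, (j < m)%N -> derivative_on01 (d j) (d j.+1)),
      {within `[0, 1], continuous (d m)} &
      exists L : R, forall x x', x \in `[0, 1] -> x' \in `[0, 1] ->
        `|d m x - d m x'| <= L * `|x - x'| `^ (a - m%:R)].

End Holder.

Section Bspline.
Context {R : realType}.

(* Knots 0 (q times), 1/K, ..., (K-1)/K, 1 (q times), indexed by
   0, ..., K + 2q - 2; both subtractions are truncated. *)
Definition knot (q K i : nat) : R := (minn (i - (q - 1)) K)%:R / K%:R.

(* Cox-de Boor recursion on the degree d. The cells are open on the left, as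
   are the intervals of the partition of (0, 1], except that 0 is put in the
   first cell; thus the functions are extended to 0 by their right limit. Terms
   with a vanishing denominator are 0, since x / 0 = 0. *)
Fixpoint cox_de_boor (t : nat -> R) (d i : nat) (x : R) : R :=
  match d with
  | 0 => ((t i < x <= t i.+1) || (x == 0) && (t i == 0) && (0 < t i.+1))%:R
  | d'.+1 =>
      (x - t i) / (t (i + d)%N - t i) * cox_de_boor t d' i x +
      (t (i + d).+1 - x) / (t (i + d).+1 - t i.+1) * cox_de_boor t d' i.+1 x
  end.

(* The basis of order q (degree q - 1) on K cells is indexed by
   i = 0, ..., K + q - 2. *)
Definition bspline (q K i : nat) (x : R) : R :=
  cox_de_boor (knot q K) (q - 1) i x.

Definition bspline_design (q n k : nat) (x : 'I_n -> R) : 'M[R]_(n, k) :=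
  \matrix_(i < n, j < k) bspline q (k + 1 - q) j (x i).

End Bspline.

Section EuclideanSpace.
Context {R : realType}.

(* The topological library's norm on matrices is the sup norm. *)
Definition enorm n (v : 'cV[R]_n) : R := Num.sqrt (\sum_i v i 0 ^+ 2).

End EuclideanSpace.

(* R^n with its Borel sigma-algebra, generated by the coordinates. *)
Notation euclid R n := (n.-tuple (measurableTypeR R)).

Section LebesgueEuclid.
Context {R : realType}.

Definition colv n (t : euclid R n) : 'cV[R]_n := \col_i tnth t i.

Definition euclid_cons n (p : measurableTypeR R * euclid R n) : euclid R n.+1 :=
  [tuple of p.1 :: p.2].

Definition euclid_uncons n (t : euclid R n.+1) : measurableTypeR R * euclid R n :=
  (thead t, [tuple of behead t]).

Lemma measurable_euclid_cons n : measurable_fun setT (@euclid_cons n).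
Proof. exact: (measurable_cons measurable_fst measurable_snd). Qed.

Lemma measurable_euclid_uncons n : measurable_fun setT (@euclid_uncons n).
Proof.
apply/measurable_fun_pair; first exact: measurable_tnth.
exact: measurable_behead.
Qed.

Lemma euclid_consK n : cancel (@euclid_cons n) (@euclid_uncons n).
Proof.
move=> [x t]; rewrite /euclid_uncons/= /thead; congr pair.
exact: val_inj.
Qed.

Lemma euclid_unconsK n : cancel (@euclid_uncons n) (@euclid_cons n).
Proof. by move=> t; rewrite [RHS]tuple_eta. Qed.

Section cons.
Variables (n : nat) (mu : {sigma_finite_measure set (euclid R n) -> \bar R}).

Definition lebesgue_cons : set (euclid R n.+1) -> \bar R :=
  pushforward (lebesgue_measure \x mu)%E (@euclid_cons n).

Let lebesgue_cons0 : lebesgue_cons set0 = 0%E.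
Proof. by rewrite /lebesgue_cons /pushforward preimage_set0 measure0. Qed.

Let lebesgue_cons_ge0 A : (0 <= lebesgue_cons A)%E.
Proof. by rewrite /lebesgue_cons /pushforward; exact: measure_ge0. Qed.

Let lebesgue_cons_sigma_additive : semi_sigma_additive lebesgue_cons.
Proof.
move=> F mF tF mUF; rewrite /lebesgue_cons /pushforward preimage_bigcup.
have mc A : measurable A -> measurable (@euclid_cons n @^-1` A).
  by move=> mA; rewrite -[X in measurable X]setTI; exact: measurable_euclid_cons.
apply: measure_semi_sigma_additive.
- by move=> i; exact: mc.
- apply/trivIsetP => /= i j _ _ ij; rewrite -preimage_setI.
  by move/trivIsetP : tF => /(_ _ _ _ _ ij) ->//; rewrite preimage_set0.
- by rewrite -preimage_bigcup; exact: mc.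
Qed.

HB.instance Definition _ := isMeasure.Build _ _ _ lebesgue_cons
  lebesgue_cons0 lebesgue_cons_ge0 lebesgue_cons_sigma_additive.

Let lebesgue_cons_sigma_finite : sigma_finite setT lebesgue_cons.
Proof.
have /sigma_finiteP[F [TF ndF Foo]] := sigma_finiteT (@lebesgue_measure R).
have /sigma_finiteP[G [TG ndG Goo]] := sigma_finiteT mu.
exists (fun i => @euclid_uncons n @^-1` (F i `*` G i)).
  rewrite -preimage_bigcup -[LHS](preimage_setT (@euclid_uncons n)).
  congr (_ @^-1` _); rewrite -setXTT TF TG predeqE => -[x y]; split.
    move=> [/= [i _ Fx] [j _ Gy]]; exists (maxn i j) => //; split.
    - by move: x Fx; exact/subsetPset/ndF/leq_maxl.
    - by move: y Gy; exact/subsetPset/ndG/leq_maxr.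
  by move=> [i _ []/= ? ?]; split; exists i.
move=> i; have [mF Fi] := Foo i; have [mG Gi] := Goo i; split.
  rewrite -[X in measurable X]setTI.
  by apply: measurable_euclid_uncons => //; exact: measurableX.
rewrite /lebesgue_cons /pushforward.
rewrite (_ : _ @^-1` _ = F i `*` G i); last first.
  rewrite -comp_preimage (_ : _ \o _ = idfun)//.
  by apply/funext => p; exact: euclid_consK.
by rewrite product_measure1E// lte_mul_pinfty// ge0_fin_numE.
Qed.

HB.instance Definition _ := Measure_isSigmaFinite.Build _ _ _ lebesgue_cons
  lebesgue_cons_sigma_finite.

End cons.

(* Lebesgue measure on R^n: the n-fold product of Lebesgue measure on R. *)
Fixpoint lebesgue_euclid (n : nat) :
    {sigma_finite_measure set (euclid R n) -> \bar R} :=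
  match n with
  | 0 => \d_ ([tuple] : euclid R 0)
  | n'.+1 => lebesgue_cons (lebesgue_euclid n')
  end.

End LebesgueEuclid.

Section Gauss.
Context {R : realType}.

Definition gauss_pdf n (m : 'cV[R]_n) (S : 'M[R]_n) (y : 'cV[R]_n) : R :=
  (Num.sqrt ((2 * pi) ^+ n * \det S))^-1 *
  expR (- (((y - m)^T *m invmx S *m (y - m)) 0 0) / 2).

Lemma gauss_pdf_ge0 n (m : 'cV[R]_n) (S : 'M[R]_n) (y : 'cV[R]_n) :
  0 <= gauss_pdf m S y.
Proof. by rewrite mulr_ge0 ?expR_ge0// invr_ge0 sqrtr_ge0. Qed.

Lemma measurable_gauss_pdf n (m : 'cV[R]_n) (S : 'M[R]_n) :
  measurable_fun setT (fun t : euclid R n => gauss_pdf m S (colv t)).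
Proof.
have mB i : measurable_fun setT (fun t : euclid R n => (colv t - m) i 0).
  rewrite (_ : (fun _ => _) = (fun t => tnth t i - m i 0)); last first.
    by apply/funext => t; rewrite !mxE.
  by apply: measurable_funB => //; exact: measurable_tnth.
have mQ : measurable_fun setT (fun t : euclid R n =>
    ((colv t - m)^T *m invmx S *m (colv t - m)) 0 0).
  rewrite (_ : (fun _ => _) = (fun t : euclid R n => \sum_j
      (\sum_i (colv t - m) i 0 * invmx S i j) * (colv t - m) j 0)); last first.
    apply/funext => t; rewrite mxE; apply: eq_bigr => j _; congr (_ * _).
    by rewrite mxE; apply: eq_bigr => i _; rewrite mxE.
  apply: measurable_sum => j; apply: measurable_funM => //.
  by apply: measurable_sum => i; exact: measurable_funM.
apply: measurable_funM => //; apply: measurableT_comp => //.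
by apply: measurable_funM => //; exact: measurableT_comp.
Qed.

Section measure.
Variables (n : nat) (m : 'cV[R]_n) (S : 'M[R]_n).

(* The law N(m, S), for S symmetric positive definite. *)
Definition gauss (A : set (euclid R n)) : \bar R :=
  (\int[lebesgue_euclid n]_(t in A) (gauss_pdf m S (colv t))%:E)%E.

Let gauss0 : gauss set0 = 0%E.
Proof. exact: integral_set0. Qed.

Let gauss_ge0 A : (0 <= gauss A)%E.
Proof. by apply: integral_ge0 => t _; rewrite lee_fin gauss_pdf_ge0. Qed.

Let gauss_sigma_additive : semi_sigma_additive gauss.
Proof.
move=> /= F mF tF mUF; rewrite /gauss ge0_integral_bigcup//; last 2 first.
- apply: measurable_funTS; apply/measurable_EFinP.
  exact: measurable_gauss_pdf.
- by move=> t _; rewrite lee_fin gauss_pdf_ge0.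
apply: is_cvg_ereal_nneg_natsum_cond => i _ _.
by apply: integral_ge0 => t _; rewrite lee_fin gauss_pdf_ge0.
Qed.

HB.instance Definition _ := isMeasure.Build _ _ _ gauss
  gauss0 gauss_ge0 gauss_sigma_additive.

End measure.
End Gauss.

(* Bayes' formula: posterior law for the prior W when p theta is the density at
   the observed value of the law of the observation given theta. *)
Definition posterior d (T : measurableType d) (R : realType)
    (W : set T -> \bar R) (p : T -> R) (A : set T) : \bar R :=
  ((\int[W]_(theta in A) (p theta)%:E) / (\int[W]_theta (p theta)%:E))%E.

Definition tv_dist d (T : measurableType d) (R : realType)
    (P Q : set T -> \bar R) : \bar R :=
  ereal_sup [set `|P A - Q A|%E | A in measurable].

Section Regression.
Context {R : realType}.

Definition lse n k (Phi : 'M[R]_(n, k)) (y : 'cV[R]_n) : 'cV[R]_k :=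
  invmx (Phi^T *m Phi) *m Phi^T *m y.

(* Posterior law of theta given Y = y, for the prior W on theta and
   Y | theta ~ N(Phi theta, sigma^2 I). *)
Definition regression_posterior n k (Phi : 'M[R]_(n, k)) (sigma : R)
    (W : set (euclid R k) -> \bar R) (y : euclid R n) :
    set (euclid R k) -> \bar R :=
  posterior W (fun theta : euclid R k =>
    gauss_pdf (Phi *m colv theta) ((sigma ^+ 2)%:M) (colv y)).

End Regression.

(* Main.v *)
(* Let A = Phi^T Phi, S = sigma^2 A^-1 and let m be the least squares estimator.
   The posterior is N(m, S) reweighted by
     w(t) = exp(-(|t|^2 - |m|^2) / (2 tau^2)),
   so its total variation distance to N(m, S) is at most four times the integral
   of |w - 1| under N(m, S). With h = t - m, the exponent of w is
   -<m, h>/tau^2 - |h|^2/(2 tau^2); its linear part has variance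
   v = m^T S m / tau^4 and its quadratic part has mean of order tr(S)/tau^2.
   Since the eigenvalues of A are at least C1 n/k, the expectations over the
   observation of these quantities are O(k^3/(n tau^4)) and O(k^2/(n tau^2)).
   The second moment of |h| under N(m, S) and that of m around its mean are
   O(k^2/n), which gives the rate of convergence by Markov's inequality.

   Gaussian integrals over R^n are computed by induction on n: integrating one
   coordinate out replaces the precision matrix by its Schur complement. Second
   moments are only bounded, up to a constant, through the moment generating
   function, which is obtained by completing the square. *)

Require Import Defs.
From mathcomp Require Import all_boot all_order all_algebra.
From mathcomp Require Import all_classical all_reals all_analysis.
From mathcomp Require Import measurable_realfun ring lra.

Set Implicit Arguments.
Unset Strict Implicit.
Unset Printing Implicit Defensive.

Import Order.TTheory GRing.Theory Num.Theory.
Import numFieldNormedType.Exports.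

Local Open Scope classical_set_scope.
Local Open Scope ring_scope.

(** * Integration against a measure given by a density *)

Section density.
Local Open Scope ereal_scope.
Context d (T : measurableType d) (R : realType).
Variables (mu nu : {measure set T -> \bar R}) (p : T -> R).
Hypothesis p0 : forall x, (0 <= p x)%R.
Hypothesis mp : measurable_fun setT p.
Hypothesis nuE : forall A, measurable A -> nu A = \int[mu]_(x in A) (p x)%:E.

Import HBNNSimple.

Let ge0_integral_density_nnsfun (h : {nnsfun T >-> R}) :
  \int[nu]_x (h x)%:E = \int[mu]_x (h x * p x)%:E.
Proof.
have mind r : measurable_fun setT (fun x => r * \1_(h @^-1` [set r]) x)%R.
  by apply: measurable_funM => //; exact: measurable_indic.
transitivity (\sum_(r \in range h) r%:E * nu (h @^-1` [set r])).
  by rewrite integral_nnsfun// patch_setT sintegralE.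
transitivity (\int[mu]_x \sum_(r \in range h)
    (r * \1_(h @^-1` [set r]) x * p x)%:E); last first.
  apply: eq_integral => x _; rewrite [in RHS](fimfunE h) EFinM -fsumEFin//.
  rewrite ge0_mule_fsuml//= => r; exact: nnfun_muleindic_ge0.
rewrite ge0_integral_fsum//; last 2 first.
- by move=> r; apply/measurable_EFinP; exact: measurable_funM.
- move=> r x _; rewrite EFinM mule_ge0 ?lee_fin//.
  exact: (nnfun_muleindic_ge0 h).
apply: eq_fsbigr => r /[!inE] -[t _ <-]; rewrite nuE//.
under [RHS]eq_integral do rewrite -mulrA EFinM.
rewrite ge0_integralZl_EFin//; last 2 first.
- by move=> x _; rewrite lee_fin mulr_ge0.
- by apply/measurable_EFinP; exact: measurable_funM.
congr *%E; rewrite integral_mkcond; apply: eq_integral => x _.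
by rewrite epatch_indic/= muleC -EFinM.
Qed.

(** Monotone convergence carries the identity over from simple functions; the domain [D] is first
    absorbed into the integrand. *)
Lemma ge0_integral_density (f : T -> \bar R) (D : set T) :
  measurable D -> (forall x, 0 <= f x) -> measurable_fun setT f ->
  \int[nu]_(x in D) f x = \int[mu]_(x in D) (f x * (p x)%:E).
Proof.
move=> mD f0 mf; rewrite integral_mkcond [RHS]integral_mkcond.
rewrite (_ : (fun x => f x * (p x)%:E) \_ D = fun x => (f \_ D) x * (p x)%:E); last first.
  by apply/funext => x; rewrite !patchE; case: ifP; rewrite ?mul0e.
have g0 : forall x, 0 <= (f \_ D) x by exact: erestrict_ge0.
have mg : measurable_fun setT (f \_ D).
  by apply/(measurable_restrictT _ _).1 => //; exact: measurable_funTS.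
move: (f \_ D) g0 mg => {f0 mf}g g0 mg.
pose h := nnsfun_approx measurableT mg.
have hg x : (h n x)%:E @[n --> \oo] --> g x by exact: cvg_nnsfun_approx.
have ndh x : {homo (h ^~ x) : m n / (m <= n)%N >-> (m <= n)%R}.
  by move=> m n mn; exact/lefP/nd_nnsfun_approx.
transitivity (limn (fun n => \int[nu]_x (h n x)%:E)).
  rewrite -monotone_convergence//.
  - by apply: eq_integral => x _; apply/esym/cvg_lim.
  - by move=> n; exact/measurable_EFinP.
  - by move=> n x _; rewrite lee_fin.
  - by move=> x _ m n mn; rewrite lee_fin ndh.
transitivity (limn (fun n => \int[mu]_x (h n x * p x)%:E)).
  by under eq_fun do rewrite ge0_integral_density_nnsfun.
rewrite -monotone_convergence//.
- apply: eq_integral => x _; apply/cvg_lim => //.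
  by under eq_fun do rewrite EFinM; apply: cvgeZr.
- by move=> n; apply/measurable_EFinP; exact: measurable_funM.
- by move=> n x _; rewrite lee_fin mulr_ge0.
- by move=> x _ m n mn; rewrite lee_fin ler_wpM2r// ndh.
Qed.

End density.

(** * Gaussian integrals *)

Section quadratic_form.
Context {R : realType}.

Definition quadf n (P : 'M[R]_n) (v : 'cV[R]_n) : R := (v^T *m P *m v) 0 0.

Lemma quadf_mul n k (L : 'M[R]_(n, k)) (B : 'M[R]_k) v :
  quadf (L *m B *m L^T) v = quadf B (L^T *m v).
Proof. by rewrite /quadf trmx_mul trmxK !mulmxA. Qed.

Definition posdef n (P : 'M[R]_n) : Prop :=
  P^T = P /\ forall v : 'cV[R]_n, v != 0 -> 0 < quadf P v.

(** Elimination of the first coordinate: [P] = L diag([a], [D]) L^T with L unit lower triangular,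
    [a] the corner entry and [D] its Schur complement. This yields both the determinant and the
    quadratic form. *)
Lemma posdef_schur n (P : 'M[R]_(1 + n)) : posdef P ->
  exists (a : R) (c : 'cV[R]_n) (D : 'M[R]_n),
    [/\ 0 < a, posdef D, \det P = a * \det D &
        forall (x : R) v, quadf P (col_mx x%:M v) =
          a * (x + (c^T *m v) 0 0) ^+ 2 + quadf D v].
Proof.
move=> [PT Pgt0].
pose a := P (lshift n 0) (lshift n 0).
pose b := dlsubmx P.
pose c := a^-1 *: b.
pose D := drsubmx P - a^-1 *: (b *m b^T).
have PE : P = block_mx a%:M b^T b (drsubmx P).
  rewrite -[LHS]submxK; congr block_mx.
    by rewrite [LHS]mx11_scalar !mxE.
  by rewrite trmx_dlsub PT.
have a0 : 0 < a.
  have := Pgt0 (col_mx 1%:M 0).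
  rewrite /quadf PE tr_col_mx mul_row_block mul_row_col !trmx0 !mul0mx !mulmx0.
  rewrite !addr0 trmx1 mul1mx mulmx1 mxE eqxx mulr1n; apply.
  rewrite col_mx_eq0 negb_and -scalemx1 scale1r; apply/orP; left.
  by apply/eqP => /matrixP/(_ 0 0)/eqP; rewrite !mxE eqxx oner_eq0.
have DT : D^T = D.
  rewrite /D linearB/= linearZ/= trmx_mul trmxK; congr (_ - _).
  by rewrite trmx_drsub PT.
have PL : P = block_mx 1%:M 0 c 1%:M *m block_mx a%:M 0 0 D
                *m (block_mx 1%:M 0 c 1%:M)^T.
  rewrite tr_block_mx !trmx1 trmx0 !mulmx_block.
  rewrite !(mul1mx, mulmx1, mulmx0, mul0mx, addr0, add0r).
  rewrite -!scalemxAl mul_scalar_mx mul_mx_scalar /c linearZ/= !scalerA.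
  rewrite mulfV ?gt_eqF// !scale1r {1}PE; congr block_mx.
    by rewrite mulVf ?scale1r// gt_eqF.
  rewrite /D -scalemxAr -scalemxAl !scalerA mulVf ?gt_eqF// mulr1.
  by rewrite addrC subrK.
have quadE (x : R) v : quadf P (col_mx x%:M v) =
    a * (x + (c^T *m v) 0 0) ^+ 2 + quadf D v.
  rewrite PL quadf_mul tr_block_mx !trmx1 trmx0 mul_block_col !mul1mx mul0mx.
  rewrite add0r /quadf.
  rewrite tr_col_mx mul_row_block !mulmx0 addr0 add0r mul_row_col.
  have -> : x%:M + c^T *m v = (x + (c^T *m v) 0 0)%:M.
    by rewrite [in LHS](mx11_scalar (c^T *m v)) raddfD.
  rewrite tr_scalar_mx -!scalar_mxM.
  rewrite [LHS]mxE; congr (_ + _).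
  by rewrite !mxE eqxx mulr1n expr2 mulrAC mulrC.
exists a, c, D; split => //.
- split=> // v v0.
  (* This first coordinate annihilates the square, so that the form of [P] takes the value of that
     of [D] at [v]. *)
  have := Pgt0 (col_mx (- (c^T *m v) 0 0)%:M v).
  rewrite quadE addNr expr0n/= mulr0 add0r; apply.
  by rewrite col_mx_eq0 negb_and v0 orbT.
- by rewrite PL !det_mulmx det_tr !det_lblock !det1 !det_scalar !mul1r mulr1.
Qed.

Lemma posdef_det_gt0 n (P : 'M[R]_n) : posdef P -> 0 < \det P.
Proof.
elim: n P => [P _|n IH P]; first by rewrite det_mx00.
by move=> /posdef_schur[a [c [D [a0 /IH D0 -> _]]]]; rewrite mulr_gt0.
Qed.

End quadratic_form.

(** * Normalization of Gaussian densities *)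

Section gauss_integral.
Context {R : realType}.

(** The integrand is a multiple of the normal density with mean [- c] and variance 1/[a], whose
    total mass is 1. *)
Lemma integral_expR_sqr (a c : R) : 0 < a ->
  (\int[lebesgue_measure]_x (expR (- (a * (x + c) ^+ 2) / 2))%:E =
   (Num.sqrt (2 * pi / a))%:E)%E.
Proof.
move=> a0; set s := Num.sqrt a^-1.
have s0 : s != 0 by rewrite gt_eqF// sqrtr_gt0 invr_gt0.
have s2 : s ^+ 2 = a^-1 by rewrite sqr_sqrtr// invr_ge0 ltW.
have peakE : normal_peak s * Num.sqrt (2 * pi / a) = 1.
  rewrite /normal_peak s2 (_ : _ *+ 2 = 2 * pi / a); last by rewrite -mulr_natl; ring.
  by rewrite mulVf// gt_eqF// sqrtr_gt0 divr_gt0// mulr_gt0// pi_gt0.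
have pdfE x : expR (- (a * (x + c) ^+ 2) / 2) =
    Num.sqrt (2 * pi / a) * normal_pdf (- c) s x.
  rewrite normal_pdfE//= [RHS]mulrA [X in _ = X * _]mulrC peakE mul1r /normal_fun.
  by rewrite s2 opprK; congr expR; rewrite -mulr_natl; field; rewrite gt_eqF.
under eq_integral do rewrite pdfE EFinM.
rewrite ge0_integralZl//.
- by rewrite integral_normal_pdf mule1.
- by apply/measurable_EFinP; exact: measurable_normal_pdf.
- by move=> x _; rewrite lee_fin normal_pdf_ge0.
Qed.

(** Tonelli's theorem, with the first coordinate innermost: it is the one that [posdef_schur] splits
    off. *)
Lemma integral_lebesgue_euclidS n (f : euclid R n.+1 -> \bar R) :
  (forall t, 0 <= f t)%E -> measurable_fun setT f ->
  (\int[lebesgue_euclid n.+1]_t f t = \int[lebesgue_euclid n]_t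
     \int[lebesgue_measure]_x f (euclid_cons (x, t)))%E.
Proof.
move=> f0 mf.
rewrite /= /lebesgue_cons ge0_integral_pushforward//; last first.
  exact: measurable_euclid_cons.
rewrite preimage_setT fubini_tonelli2//=.
by apply: measurableT_comp => //; exact: measurable_euclid_cons.
Qed.

Lemma colv_cons n (x : R) (t : euclid R n) :
  colv (euclid_cons (x, t)) = col_mx x%:M (colv t) :> 'cV_(1 + n).
Proof.
apply/colP => i; rewrite mxE [RHS]mxE /euclid_cons/=.
case: splitP => j ij; rewrite !mxE (tnth_nth 0) ij ?(tnth_nth 0)//.
by rewrite ord1 eqxx mulr1n.
Qed.

Lemma measurable_coord n (m : 'cV[R]_n) i :
  measurable_fun setT (fun t : euclid R n => (colv t - m) i 0).
Proof.
rewrite (_ : (fun _ => _) = (fun t => tnth t i - m i 0)); last first.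
  by apply/funext => t; rewrite !mxE.
by apply: measurable_funB => //; exact: measurable_tnth.
Qed.

Lemma measurable_linear n k (M : 'M[R]_(k, n)) (m : 'cV[R]_n) i :
  measurable_fun setT (fun t : euclid R n => (M *m (colv t - m)) i 0).
Proof.
under eq_fun do rewrite mxE.
apply: measurable_sum => j; apply: measurable_funM => //.
exact: measurable_coord.
Qed.

Lemma measurable_quadf n (P : 'M[R]_n) (m : 'cV[R]_n) :
  measurable_fun setT (fun t : euclid R n => quadf P (colv t - m)).
Proof.
rewrite (_ : (fun _ => _) = (fun t : euclid R n => \sum_i
    (colv t - m) i 0 * (P *m (colv t - m)) i 0)); last first.
  by apply/funext => t; rewrite /quadf -mulmxA mxE; apply: eq_bigr => j _; rewrite mxE.
apply: measurable_sum => j; apply: measurable_funM; first exact: measurable_coord.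
exact: measurable_linear.
Qed.

Lemma measurable_expR_quadf n (P : 'M[R]_n) (m : 'cV[R]_n) :
  measurable_fun setT (fun t : euclid R n => expR (- quadf P (colv t - m) / 2)).
Proof.
apply: measurableT_comp => //; apply: measurable_funM => //.
by apply: measurableT_comp => //; exact: measurable_quadf.
Qed.

Lemma integral_expR_quadf n (P : 'M[R]_n) (m : 'cV[R]_n) : posdef P ->
  (\int[lebesgue_euclid n]_t (expR (- quadf P (colv t - m) / 2))%:E =
   (Num.sqrt ((2 * pi) ^+ n / \det P))%:E)%E.
Proof.
elim: n P m => [|n IH] P m Ppos.
  rewrite /= integral_dirac//; last first.
    by apply/measurable_EFinP; exact: measurable_expR_quadf.
  by rewrite diracT mul1e det_mx00 expr0 divr1 sqrtr1 /quadf mxE big_ord0 oppr0 mul0r expR0.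
have [a [c [D [a0 Dpos detP quadE]]]] := posdef_schur Ppos.
rewrite integral_lebesgue_euclidS//; last first.
  by apply/measurable_EFinP; exact: measurable_expR_quadf.
pose m0 := (usubmx (m : 'cV_(1 + n))) 0 0.
pose m' := dsubmx (m : 'cV_(1 + n)).
have mE : m = col_mx m0%:M m' by rewrite -mx11_scalar vsubmxK.
have subE x t : colv (euclid_cons (x, t)) - m =
    col_mx (x - m0)%:M (colv t - m') :> 'cV_(1 + n).
  transitivity ((col_mx x%:M (colv t) : 'cV[R]_(1 + n)) - col_mx m0%:M m').
    by rewrite colv_cons -mE.
  by rewrite opp_col_mx add_col_mx raddfB.
(* For fixed [t], the factor in [x] is a one-dimensional Gaussian whose centre depends on [t] but
   whose integral does not; the remaining factor is governed by [D]. *)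
under eq_integral => t _.
  under eq_integral => x _.
    rewrite subE quadE opprD mulrDl expRD EFinM -addrA.
    over.
  rewrite /= ge0_integralZr//; last first.
    apply/measurable_EFinP; apply: measurableT_comp => //.
    apply: measurable_funM => //; apply: measurableT_comp => //.
    apply: measurable_funM => //; apply: measurable_funX.
    exact: measurable_funD.
  rewrite integral_expR_sqr//.
  over.
rewrite /= ge0_integralZl//; last first.
  by apply/measurable_EFinP; exact: measurable_expR_quadf.
rewrite IH// -EFinM -sqrtrM ?divr_ge0 ?mulr_ge0 ?pi_ge0 ?(ltW a0)// detP.
by rewrite exprS invfM mulrACA.
Qed.

End gauss_integral.

(** * Inner products and positive definite matrices *)

Section inner_product.
Context {R : realType}.

Definition dot n (u v : 'cV[R]_n) : R := (u^T *m v) 0 0.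

Lemma dotE n (u v : 'cV[R]_n) : dot u v = \sum_i u i 0 * v i 0.
Proof. by rewrite /dot mxE; apply: eq_bigr => i _; rewrite mxE. Qed.

Lemma dotC n (u v : 'cV[R]_n) : dot u v = dot v u.
Proof. by rewrite !dotE; apply: eq_bigr => i _; rewrite mulrC. Qed.

Lemma dotDr n (u v w : 'cV[R]_n) : dot u (v + w) = dot u v + dot u w.
Proof. by rewrite /dot mulmxDr mxE. Qed.

Lemma dotZr n a (u v : 'cV[R]_n) : dot u (a *: v) = a * dot u v.
Proof. by rewrite /dot -scalemxAr mxE. Qed.

Lemma dotNr n (u v : 'cV[R]_n) : dot u (- v) = - dot u v.
Proof. by rewrite /dot mulmxN mxE. Qed.

Lemma dotDl n (u v w : 'cV[R]_n) : dot (v + w) u = dot v u + dot w u.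
Proof. by rewrite dotC dotDr !(dotC u). Qed.

Lemma dotZl n a (u v : 'cV[R]_n) : dot (a *: v) u = a * dot v u.
Proof. by rewrite dotC dotZr dotC. Qed.

Lemma dotNl n (u v : 'cV[R]_n) : dot (- v) u = - dot v u.
Proof. by rewrite dotC dotNr dotC. Qed.

Lemma dot_mulmxl n k (M : 'M[R]_(n, k)) u v : dot (M *m u) v = dot u (M^T *m v).
Proof. by rewrite /dot trmx_mul mulmxA. Qed.

Lemma dot_ge0 n (v : 'cV[R]_n) : 0 <= dot v v.
Proof. by rewrite dotE sumr_ge0// => i _; rewrite -expr2 sqr_ge0. Qed.

Lemma dot_gt0 n (v : 'cV[R]_n) : v != 0 -> 0 < dot v v.
Proof.
move=> v0; rewrite lt_def dot_ge0 andbT; apply: contra v0.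
rewrite dotE psumr_eq0 => [/allP v0|i _]; last by rewrite -expr2 sqr_ge0.
apply/eqP/colP => i; rewrite mxE; apply/eqP.
by have := v0 i (mem_index_enum _); rewrite mulf_eq0 orbb.
Qed.

(** The difference of the two sides is |u - v|^2. *)
Lemma dot_sqD_le n (u v : 'cV[R]_n) :
  dot (u + v) (u + v) <= 2 * dot u u + 2 * dot v v.
Proof.
have := dot_ge0 (u - v).
by rewrite !(dotDl, dotDr, dotNl, dotNr) (dotC v u); lra.
Qed.

Lemma enorm_sqr n (v : 'cV[R]_n) : enorm v ^+ 2 = dot v v.
Proof.
rewrite sqr_sqrtr ?dotE; last by rewrite sumr_ge0// => i _; rewrite sqr_ge0.
by apply: eq_bigr => i _; rewrite expr2.
Qed.

Lemma quadf_dot n (P : 'M[R]_n) v : quadf P v = dot v (P *m v).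
Proof. by rewrite /quadf /dot mulmxA. Qed.

Lemma posdef1 n : posdef (1%:M : 'M[R]_n).
Proof.
by split=> [|v v0]; rewrite ?trmx1// quadf_dot mul1mx dot_gt0.
Qed.

Lemma posdefZ n a (P : 'M[R]_n) : 0 < a -> posdef P -> posdef (a *: P).
Proof.
move=> a0 [PT P0]; split=> [|v v0]; first by rewrite linearZ/= PT.
by rewrite quadf_dot -scalemxAl dotZr -quadf_dot mulr_gt0// P0.
Qed.

Lemma posdef_scalar n a : 0 < a -> posdef (a%:M : 'M[R]_n).
Proof. by move=> a0; rewrite -scalemx1; apply: posdefZ => //; exact: posdef1. Qed.

Lemma posdef_unit n (P : 'M[R]_n) : posdef P -> P \in unitmx.
Proof. by move=> /posdef_det_gt0 P0; rewrite unitmxE unitfE gt_eqF. Qed.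

Lemma posdef_inv n (P : 'M[R]_n) : posdef P -> posdef (invmx P).
Proof.
move=> Ppos; have uP := posdef_unit Ppos; have [PT P0] := Ppos.
split=> [|v v0]; first by rewrite trmx_inv PT.
have -> : quadf (invmx P) v = quadf P (invmx P *m v).
  by rewrite !quadf_dot mulKVmx// dotC.
apply: P0; apply: contra v0 => /eqP Pv.
by rewrite -(mulKVmx uP v) Pv mulmx0.
Qed.

Lemma posdef_quadf_ge0 n (P : 'M[R]_n) v : posdef P -> 0 <= quadf P v.
Proof.
move=> [_ P0]; have [->|/P0/ltW//] := eqVneq v 0.
by rewrite quadf_dot mulmx0 /dot mulmx0 mxE.
Qed.

Lemma quadfD n (P : 'M[R]_n) u v : P^T = P ->
  quadf P (u + v) = quadf P u + 2 * dot v (P *m u) + quadf P v.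
Proof.
move=> PT; rewrite !quadf_dot mulmxDr dotDr !dotDl.
have -> : dot u (P *m v) = dot v (P *m u) by rewrite dotC dot_mulmxl PT.
ring.
Qed.

(** Absorbs a linear term of a Gaussian exponent into a shift of the centre by [S *m v], for
    [gauss_mgf]. *)
Lemma quadf_complete_square n (S : 'M[R]_n) h v : posdef S ->
  quadf (invmx S) (h - S *m v) = quadf (invmx S) h - 2 * dot v h + quadf S v.
Proof.
move=> Spos; have uS := posdef_unit Spos.
rewrite quadfD; last by case: (posdef_inv Spos).
have -> : quadf (invmx S) (- (S *m v)) = quadf S v.
  by rewrite !quadf_dot mulmxN mulKmx// dotNr dotNl opprK dotC.
by rewrite dotNl dot_mulmxl Spos.1 mulKVmx// mulrN.
Qed.

End inner_product.

(** * Moments of Gaussian laws *)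

Section gaussian_law.
Context {R : realType}.

Lemma gauss_pdfE n (m : 'cV[R]_n) S y : gauss_pdf m S y =
  (Num.sqrt ((2 * pi) ^+ n * \det S))^-1 * expR (- quadf (invmx S) (y - m) / 2).
Proof. by []. Qed.

Lemma gauss_setT n (m : 'cV[R]_n) S : posdef S -> gauss m S setT = 1%E.
Proof.
move=> Spos; have S0 := posdef_det_gt0 Spos.
rewrite /gauss; under eq_integral do rewrite gauss_pdfE EFinM.
rewrite ge0_integralZl//; last first.
  by apply/measurable_EFinP; exact: measurable_expR_quadf.
rewrite (integral_expR_quadf m (posdef_inv Spos)) det_inv invrK -EFinM mulVf//.
by rewrite gt_eqF// sqrtr_gt0 mulr_gt0// exprn_gt0// mulr_gt0// pi_gt0.
Qed.

Lemma ge0_integral_gauss n (m : 'cV[R]_n) S (D : set (euclid R n)) f :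
  measurable D -> (forall t, 0 <= f t)%E -> measurable_fun setT f ->
  (\int[gauss m S]_(t in D) f t =
   \int[lebesgue_euclid n]_(t in D) (f t * (gauss_pdf m S (colv t))%:E))%E.
Proof.
move=> mD f0 mf; apply: ge0_integral_density => //.
- by move=> t; exact: gauss_pdf_ge0.
- exact: measurable_gauss_pdf.
Qed.

Lemma integral_gauss_cst n (m : 'cV[R]_n) S (c : R) : posdef S ->
  (\int[gauss m S]_t c%:E = c%:E)%E.
Proof. by move=> Spos; rewrite integral_cst//= gauss_setT// mule1. Qed.

Lemma measurable_dot n (v m : 'cV[R]_n) :
  measurable_fun setT (fun t : euclid R n => dot v (colv t - m)).
Proof. exact: measurable_linear. Qed.

(** By completing the square, exp(<v, t - m>) times the density of N(m, S) is exp(v^T S v / 2) times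
    the density of N(m + S v, S), which has mass 1. *)
Lemma gauss_mgf n (m : 'cV[R]_n) S v : posdef S ->
  (\int[gauss m S]_t (expR (dot v (colv t - m)))%:E =
   (expR (quadf S v / 2))%:E)%E.
Proof.
move=> Spos; rewrite ge0_integral_gauss//; last first.
  by apply/measurable_EFinP; apply: measurableT_comp => //; exact: measurable_dot.
under eq_integral => t _.
  rewrite -EFinM (_ : _ * _ = expR (quadf S v / 2) *
      gauss_pdf (m + S *m v) S (colv t)); last first.
    rewrite !gauss_pdfE opprD addrA.
    rewrite quadf_complete_square// mulrCA [RHS]mulrCA -!expRD.
    by congr (_ * expR _); field.
  rewrite EFinM.
  over.
rewrite ge0_integralZl//; last 2 first.
- by apply/measurable_EFinP; exact: measurable_gauss_pdf.
- by move=> t _; rewrite lee_fin gauss_pdf_ge0.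
by have := gauss_setT (m + S *m v) Spos; rewrite /gauss => ->; rewrite mule1.
Qed.

Lemma sqr_le_expR (x : R) : x ^+ 2 <= 2 * (expR x + expR (- x)).
Proof.
have H (y : R) : 0 <= y -> y ^+ 2 <= 2 * expR y.
  move=> y0; have := expR_ge1Dxn 1 y0; rewrite (_ : 2`!%:R = 2 :> R)//.
  by rewrite -ler_pdivrMl//; lra.
have [x0|/ltW x0] := leP 0 x.
  by apply: (le_trans (H _ x0)); rewrite ler_pM2l// lerDl expR_ge0.
rewrite -sqrrN; apply: (le_trans (H (- x) _)); first by rewrite oppr_ge0.
by rewrite ler_pM2l// lerDr expR_ge0.
Qed.

(** Apply [sqr_le_expR] to the variable rescaled to variance at most 1: each exponential then has
    mean at most e^(1/2) <= 2, whence 8 c = 2 c (2 + 2). A bound [c] > 0 stands in for the variance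
    because [v] may be 0 and the rescaling divides by the root. *)
Lemma gauss_second_moment n (m : 'cV[R]_n) S v (c : R) : posdef S ->
  0 < c -> quadf S v <= c ->
  (\int[gauss m S]_t (dot v (colv t - m) ^+ 2)%:E <= (8 * c)%:E)%E.
Proof.
move=> Spos c0 Sv.
pose r := Num.sqrt c.
have r0 : 0 < r by rewrite sqrtr_gt0.
have rr : r ^+ 2 = c by rewrite sqr_sqrtr// ltW.
pose w := r^-1 *: v.
have mexp u : measurable_fun setT (fun t : euclid R n => expR (dot u (colv t - m))).
  by apply: measurableT_comp => //; exact: measurable_dot.
have qw : quadf S w <= 1.
  rewrite quadf_dot linearZ/= dotZr dotZl -quadf_dot mulrA -expr2 exprVn rr.
  by rewrite mulrC ler_pdivrMr// mul1r.
have qNw : quadf S (- w) <= 1.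
  by rewrite quadf_dot linearN/= dotNr dotNl opprK -quadf_dot.
apply: (@le_trans _ _ (\int[gauss m S]_t ((2 * c)%:E *
    ((expR (dot w (colv t - m)))%:E + (expR (dot (- w) (colv t - m)))%:E)))%E).
  apply: ge0_le_integral => //.
  - by move=> t _; rewrite lee_fin sqr_ge0.
  - by apply/measurable_EFinP; apply: measurable_funX; exact: measurable_dot.
  - apply: measurable_funeM; apply: emeasurable_funD; exact/measurable_EFinP.
  - move=> t _; rewrite -EFinD -EFinM lee_fin dotNl.
    have -> : dot v (colv t - m) = r * dot w (colv t - m).
      by rewrite dotZl mulVKf// gt_eqF.
    rewrite exprMn rr [2 * c]mulrC -mulrA ler_pM2l//.
    exact: sqr_le_expR.
rewrite ge0_integralZl_EFin//; last 3 first.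
- by move=> t _; rewrite -EFinD lee_fin addr_ge0 ?expR_ge0.
- by apply: emeasurable_funD; exact/measurable_EFinP.
- by rewrite mulr_ge0// ltW.
rewrite ge0_integralD//; last 2 first.
- exact/measurable_EFinP.
- exact/measurable_EFinP.
rewrite !gauss_mgf// -EFinD -EFinM lee_fin.
(* Inverse of e^(-1/2) >= 1 - 1/2. *)
have e2 : expR (2^-1 : R) <= 2.
  have := expR_ge1Dx (- (2^-1) : R); rewrite expRN => h.
  rewrite -[leLHS]invrK -[leRHS]invrK lef_pV2 ?posrE ?invr_gt0 ?expR_gt0//.
  by apply: le_trans h; lra.
have ex u : quadf S u <= 1 -> expR (quadf S u / 2) <= 2.
  by move=> u1; apply: le_trans e2; rewrite ler_expR; lra.
have := ex _ qw; have := ex _ qNw => h1 h2.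
have -> : 8 * c = 2 * c * (2 + 2) by ring.
by rewrite ler_pM2l ?mulr_gt0// lerD.
Qed.

(** Coordinate [i] has variance [(M *m S *m M^T) i i]. The matrix [M] lets one bound serve for the
    least squares estimator and, with [M] the identity, for N(m, S) itself. *)
Lemma gauss_sqnorm_moment n k (m : 'cV[R]_n) S (M : 'M[R]_(k, n)) (c : R) :
  posdef S ->
  0 < c -> (forall i, (M *m S *m M^T) i i <= c) ->
  (\int[gauss m S]_t (dot (M *m (colv t - m)) (M *m (colv t - m)))%:E
    <= (8 * c * k%:R)%:E)%E.
Proof.
move=> Spos c0 Mc.
have rowE i t : (M *m (colv t - m)) i 0 = dot (row i M)^T (colv t - m).
  by rewrite /dot trmxK -row_mul [RHS]mxE.
under eq_integral do rewrite dotE -sumEFin.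
rewrite ge0_integral_sum//; last 2 first.
- move=> i; apply/measurable_EFinP; apply: measurable_funM; exact: measurable_linear.
- by move=> i t _; rewrite lee_fin -expr2 sqr_ge0.
rewrite mulr_natr -[in leRHS](card_ord k) -sumr_const -sumEFin.
apply: lee_sum => i _.
under eq_integral do rewrite -expr2 rowE.
apply: gauss_second_moment => //; apply: le_trans (Mc i).
rewrite /quadf trmxK -row_mul !mxE le_eqVlt; apply/orP; left; apply/eqP.
by apply: eq_bigr => j _; rewrite !mxE.
Qed.

End gaussian_law.

(** * Total variation under a change of density *)

Section reweighting.
Context d (T : measurableType d) (R : realType).
Variables (Q : {measure set T -> \bar R}) (w : T -> R).
Hypothesis Q1 : Q setT = 1%E.
Hypothesis w0 : forall t, 0 < w t.
Hypothesis mw : measurable_fun setT w.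

(** Here [N] and [Z] stand for the integrals of the weight over an event and over the whole space,
    [q] for the probability of the event and [D] for a bound on the mean of |w - 1|. If D > 1/2 the
    claim is trivial; otherwise |N - q Z| <= 2 D and Z >= 1/2. *)
Lemma ratio_dist_le (N Z q D : R) : 0 < Z -> 0 <= N <= Z -> 0 <= q <= 1 ->
  N <= q + D -> q <= N + D -> Z <= 1 + D -> 1 <= Z + D ->
  `|N / Z - q| <= 4 * D.
Proof.
move=> Z0 /andP[N0 NZ] /andP[q0 q1] h1 h2 h3 h4.
have D0 : 0 <= D by lra.
have [D2|D2] := leP D 2^-1; last first.
  have /andP[r0 r1] : 0 <= N / Z <= 1.
    by rewrite divr_ge0 ?(ltW Z0)//= ler_pdivrMr// mul1r.
  by rewrite ler_norml; apply/andP; split; lra.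
have -> : N / Z - q = (N - q * Z) / Z by field; rewrite gt_eqF.
rewrite normrM normfV (gtr0_norm Z0) ler_pdivrMr//.
have : `|N - q * Z| <= 2 * D by rewrite ler_norml; apply/andP; split; nra.
by move=> /le_trans; apply; nra.
Qed.

(** A positive weight of integral 0 would vanish almost everywhere, so the whole space would be a
    null set. *)
Lemma integral_gt0_weight : (0 < \int[Q]_t (w t)%:E)%E.
Proof.
rewrite lt0e; apply/andP; split; last first.
  by apply: integral_ge0 => t _; rewrite lee_fin ltW.
apply/eqP => Z0.
have : (\int[Q]_t `|(w t)%:E| = 0)%E.
  rewrite -[RHS]Z0; apply: eq_integral => t _.
  by rewrite gee0_abs// lee_fin ltW.
move=> /(ae_eq_integral_abs Q measurableT).
case=> [|N [mN QN sN]]; first exact/measurable_EFinP.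
have NT : N = setT.
  apply/seteqP; split=> // t _; apply: sN => /= /(_ I)[] wt0.
  by have := w0 t; rewrite wt0 ltxx.
by move: QN; rewrite NT Q1 => /eqP; rewrite onee_eq0.
Qed.

(** Integrate w <= 1 + |w - 1| and 1 <= w + |w - 1|. The additive form avoids subtracting extended
    reals. *)
Lemma integral_weight_le (D : R) B : measurable B ->
  (\int[Q]_t `|w t - 1|%:E <= D%:E)%E ->
  (\int[Q]_(t in B) (w t)%:E <= Q B + D%:E)%E /\
  (Q B <= \int[Q]_(t in B) (w t)%:E + D%:E)%E.
Proof.
move=> mB wD.
have mw1 : measurable_fun setT (fun t => `|w t - 1|%:E).
  apply/measurable_EFinP; apply: measurableT_comp => //.
  exact: measurable_funB.
have mwE : measurable_fun B (EFin \o w) by apply/measurable_EFinP/measurable_funTS.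
have wDB : (\int[Q]_(t in B) `|w t - 1|%:E <= D%:E)%E.
  apply: le_trans wD; apply: ge0_subset_integral => //.
have QBE : Q B = (\int[Q]_(t in B) 1%:E)%E by rewrite integral_cst// mul1e.
rewrite QBE; split.
  apply: le_trans (leeD2l _ wDB); rewrite -ge0_integralD//; last first.
    exact: measurable_funTS.
  apply: ge0_le_integral => //.
  - by move=> t _; rewrite lee_fin ltW.
  - by apply: emeasurable_funD => //; exact: measurable_funTS.
  - by move=> t _; rewrite -EFinD lee_fin -lerBlDl ler_norm.
apply: le_trans (leeD2l _ wDB); rewrite -ge0_integralD//; last 2 first.
- by move=> t _; rewrite lee_fin ltW.
- exact: measurable_funTS.
apply: ge0_le_integral => //.
- by apply: emeasurable_funD => //; exact: measurable_funTS.
- move=> t _; rewrite -EFinD lee_fin -lerBlDl.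
  by rewrite -normrN opprB ler_norm.
Qed.

(** The factor [c] cancels. The bound by 1 is recorded as well: it takes over in [tv_dist_tilt]
    where the first bound grows exponentially. *)
Lemma tv_dist_reweight (P : set T -> \bar R) (c D : R) : 0 < c ->
  (\int[Q]_t `|w t - 1|%:E <= D%:E)%E ->
  (forall B, measurable B -> P B =
    (c%:E * \int[Q]_(t in B) (w t)%:E) / (c%:E * \int[Q]_t (w t)%:E))%E ->
  (tv_dist P Q <= (4 * D)%:E)%E /\ (tv_dist P Q <= 1)%E.
Proof.
move=> c0 wD PE.
have [ZD DZ] := integral_weight_le measurableT wD.
have finQ B : measurable B -> Q B \is a fin_num.
  move=> mB; rewrite ge0_fin_numE//; apply: (@le_lt_trans _ _ (Q setT)).
    by apply: le_measure; rewrite ?inE.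
  by rewrite Q1 ltry.
have finN B : measurable B -> (\int[Q]_(t in B) (w t)%:E)%E \is a fin_num.
  move=> mB; rewrite ge0_fin_numE; last first.
    by apply: integral_ge0 => t _; rewrite lee_fin ltW.
  apply: (le_lt_trans (integral_weight_le mB wD).1).
  by rewrite lte_add_pinfty ?ltry// -ge0_fin_numE// finQ.
have [Z ZE] : exists Z, (\int[Q]_t (w t)%:E)%E = Z%:E.
  by exists (fine (\int[Q]_t (w t)%:E)%E); rewrite fineK// finN.
have Z0 : 0 < Z by have := integral_gt0_weight; rewrite ZE.
move: ZD DZ; rewrite Q1 ZE -!EFinD !lee_fin => ZD DZ.
have key B : measurable B -> exists N q, [/\ P B = (N / Z)%:E, Q B = q%:E,
    0 <= N <= Z, 0 <= q <= 1 & N <= q + D /\ q <= N + D].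
  move=> mB; have [h1 h2] := integral_weight_le mB wD.
  have [N NE] : exists N, (\int[Q]_(t in B) (w t)%:E)%E = N%:E.
    by exists (fine (\int[Q]_(t in B) (w t)%:E)%E); rewrite fineK// finN.
  have [q qE] : exists q, Q B = q%:E by exists (fine (Q B)); rewrite fineK// finQ.
  exists N, q; split=> //.
  - rewrite PE// NE ZE -!EFinM inver mulf_eq0 !gt_eqF//= -EFinM.
    by congr EFin; field; rewrite !gt_eqF.
  - rewrite -!lee_fin -NE -ZE; apply/andP; split.
      by apply: integral_ge0 => t _; rewrite lee_fin ltW.
    apply: ge0_subset_integral => //; first exact/measurable_EFinP.
    by move=> t _; rewrite lee_fin ltW.
  - rewrite -!lee_fin -qE measure_ge0/= -Q1.
    by apply: le_measure; rewrite ?inE.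
  - by move: h1 h2; rewrite NE qE -!EFinD !lee_fin.
split; apply: ge_ereal_sup => _ [B mB <-];
    have [N [q [-> -> /[dup] NZ /andP[N0 N1] /[dup] q01 /andP[q0 q1] [h1 h2]]]] := key B mB.
  by rewrite -EFinB lee_fin ratio_dist_le.
rewrite -EFinB lee_fin.
have /andP[r0 r1] : 0 <= N / Z <= 1.
  by rewrite divr_ge0 ?(ltW Z0)//= ler_pdivrMr// mul1r.
by rewrite ler_norml; apply/andP; split; lra.
Qed.

Lemma tv_dist_upper (P : set T -> \bar R) B : measurable B ->
  (P B <= Q B + tv_dist P Q)%E.
Proof.
move=> mB; have QB : Q B \is a fin_num.
  rewrite ge0_fin_numE//; apply: (@le_lt_trans _ _ (Q setT)).
    by apply: le_measure; rewrite ?inE.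
  by rewrite Q1 ltry.
rewrite -leeBlDl//; apply: (le_trans (lee_abs _)).
by apply: ereal_sup_ubound; exists B.
Qed.

End reweighting.

(** * Deviation of the posterior weight from 1 under a Gaussian law *)

Section gaussian_weight.
Context {R : realType}.

(* Splits off the nonnegative quadratic part [b] of the exponent, so that only
   the linear part [a] needs an exponential moment. *)
Lemma expR_sub1_le (a b e : R) : 0 <= b -> 0 < e ->
  `|expR (- (a + b)) - 1| <= e / 2 + (expR (- a) - 1) ^+ 2 / (2 * e) + b.
Proof.
move=> b0 e0.
have Eb : 1 - b <= expR (- b) <= 1.
  by rewrite expR_ge1Dx/= -expR0 ler_expR oppr_le0.
have -> : expR (- (a + b)) - 1 =
    (expR (- a) - 1) * expR (- b) + (expR (- b) - 1).
  by rewrite opprD expRD; ring.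
(* Young's inequality with a free parameter [e]: a second moment then bounds the mean of |exp(-a) -
   1|. *)
have Y0 : `|expR (- a) - 1| <= e / 2 + (expR (- a) - 1) ^+ 2 / (2 * e).
  rewrite -(real_normK (num_real (expR (- a) - 1))); move: `| _ | => y.
  rewrite -subr_ge0 (_ : _ - _ = (y - e) ^+ 2 / (2 * e)).
    by rewrite divr_ge0 ?sqr_ge0// mulr_ge0// ltW.
  by field; rewrite gt_eqF.
apply: (le_trans (ler_normD _ _)); apply: lerD.
  rewrite normrM; apply: le_trans Y0.
  by rewrite ler_piMr// ger0_norm ?expR_ge0//; case/andP: Eb.
by rewrite ler_norml; apply/andP; split; lra.
Qed.

(** With q = u^T S u, expanding the square gives exactly exp(2 q) - 2 exp(q / 2) + 1, and exp(q / 2)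
    >= 1. *)
Lemma gauss_expR_dispersion n (m : 'cV[R]_n) S u : posdef S ->
  (\int[gauss m S]_t ((expR (- dot u (colv t - m)) - 1) ^+ 2)%:E
    <= (expR (2 * quadf S u) - 1)%:E)%E.
Proof.
move=> Spos; set X := (X in (X <= _)%E).
have mexp v : measurable_fun setT (fun t : euclid R n => (expR (dot v (colv t - m)))%:E).
  apply/measurable_EFinP; apply: measurableT_comp => //; exact: measurable_dot.
(* The cross term stands on the left so that only nonnegative functions are integrated. *)
have XE : (X + (2 * expR (quadf S u / 2))%:E = (expR (2 * quadf S u) + 1)%:E)%E.
  have qN : quadf S (- u) = quadf S u.
    by rewrite !quadf_dot mulmxN dotNl dotNr opprK.
  have q2 : quadf S (2 *: (- u)) / 2 = 2 * quadf S u.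
    by rewrite quadf_dot -scalemxAr dotZl dotZr -quadf_dot qN; field.
  rewrite EFinM -[in LHS]qN -(gauss_mgf m (- u) Spos) -ge0_integralZl//.
  rewrite /X -ge0_integralD//; last 3 first.
  - by move=> t _; rewrite lee_fin sqr_ge0.
  - apply/measurable_EFinP; apply: measurable_funX; apply: measurable_funB => //.
    by apply: measurableT_comp => //; apply: measurableT_comp => //; exact: measurable_dot.
  - exact: measurable_funeM.
  have -> : ((expR (2 * quadf S u) + 1)%:E =
      \int[gauss m S]_t (expR (dot (2 *: - u) (colv t - m)))%:E +
      \int[gauss m S]_t 1%:E)%E.
    by rewrite gauss_mgf// integral_gauss_cst// q2.
  rewrite -ge0_integralD//; apply: eq_integral => t _.
  rewrite -EFinM -!EFinD dotZl dotNl expRM_natl; congr EFin; ring.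
have XD : X = (expR (2 * quadf S u) + 1 - 2 * expR (quadf S u / 2))%:E.
  move: XE; case: X => [r| |]//=.
  by rewrite -EFinD => -[<-]; congr EFin; ring.
rewrite XD lee_fin.
have : 1 <= expR (quadf S u / 2).
  by rewrite -expR0 ler_expR divr_ge0// posdef_quadf_ge0.
lra.
Qed.

Lemma dot_add_sub n (m u : 'cV[R]_n) :
  dot u u - dot m m = 2 * dot m (u - m) + dot (u - m) (u - m).
Proof. by rewrite !(dotDl, dotDr, dotNl, dotNr) (dotC m u); ring. Qed.

(* Up to a constant factor, the density of the posterior with respect to its
   Gaussian approximation N(m, S), when m is the least squares estimator. *)
Definition tilt n (tau : R) (m : 'cV[R]_n) (t : euclid R n) : R :=
  expR (- ((dot (colv t) (colv t) - dot m m) / (2 * tau ^+ 2))).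

Lemma measurable_tilt n tau (m : 'cV[R]_n) : measurable_fun setT (tilt tau m).
Proof.
apply: measurableT_comp => //; apply: measurableT_comp => //.
apply: measurable_funM => //; apply: measurable_funB => //.
rewrite (_ : (fun _ => _) = fun t : euclid R n => quadf 1%:M (colv t - 0)).
  exact: measurable_quadf.
by apply/funext => t; rewrite subr0 quadf_dot mul1mx.
Qed.

(** With h = t - m, the exponent of [tilt] is minus the sum of <u, h>, where u = m / tau^2, and
    |h|^2 / (2 tau^2). [gauss_expR_dispersion] handles the former; the latter has mean at most 8 c n
    / (2 tau^2). *)
Lemma gauss_tilt_deviation n (m : 'cV[R]_n) S (tau e c : R) : posdef S ->
  0 < tau -> 0 < e -> 0 < c -> (forall i, S i i <= c) ->
  (\int[gauss m S]_t `|tilt tau m t - 1|%:E <=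
    (e / 2 + (expR (2 * (quadf S m / tau ^+ 4)) - 1) / (2 * e)
       + 4 * c * n%:R / tau ^+ 2)%:E)%E.
Proof.
move=> Spos tau0 e0 c0 Sc.
have t2 : 0 < tau ^+ 2 by rewrite exprn_gt0.
pose u := (tau ^+ 2)^-1 *: m.
pose g (t : euclid R n) := (expR (- dot u (colv t - m)) - 1) ^+ 2.
pose b (t : euclid R n) := dot (1%:M *m (colv t - m)) (1%:M *m (colv t - m)).
have qu : quadf S u = quadf S m / tau ^+ 4.
  rewrite !quadf_dot -scalemxAr dotZl dotZr; field; rewrite gt_eqF//.
have mg : measurable_fun setT g.
  apply: measurable_funX; apply: measurable_funB => //.
  by apply: measurableT_comp => //; apply: measurableT_comp => //; exact: measurable_dot.
have mb : measurable_fun setT b.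
  rewrite (_ : b = fun t : euclid R n => quadf 1%:M (colv t - m)).
    exact: measurable_quadf.
  by apply/funext => t; rewrite /b quadf_dot mul1mx.
have b0 t : 0 <= b t by exact: dot_ge0.
have g0 t : 0 <= g t by exact: sqr_ge0.
have e2 : 0 <= e / 2 by rewrite divr_ge0// ltW.
have i2e : 0 <= (2 * e)^-1 by rewrite invr_ge0 mulr_ge0// ltW.
have i2t : 0 <= (2 * tau ^+ 2)^-1 by rewrite invr_ge0 mulr_ge0// ltW.
apply: (@le_trans _ _ (\int[gauss m S]_t ((e / 2)%:E + (2 * e)^-1%:E * (g t)%:E
    + (2 * tau ^+ 2)^-1%:E * (b t)%:E))%E).
  apply: ge0_le_integral => //.
  - apply/measurable_EFinP; apply: measurableT_comp => //.
    by apply: measurable_funB => //; exact: measurable_tilt.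
  - apply: emeasurable_funD; last by apply: measurable_funeM; exact/measurable_EFinP.
    apply: emeasurable_funD => //; apply: measurable_funeM; exact/measurable_EFinP.
  - move=> t _; rewrite -!EFinM -!EFinD lee_fin /tilt dot_add_sub.
    have -> : (2 * dot m (colv t - m) + dot (colv t - m) (colv t - m)) / (2 * tau ^+ 2)
        = dot u (colv t - m) + b t / (2 * tau ^+ 2).
      by rewrite /b mul1mx dotZl; field; rewrite gt_eqF.
    rewrite [(2 * e)^-1 * _]mulrC [(2 * tau ^+ 2)^-1 * _]mulrC.
    by apply: expR_sub1_le => //; rewrite divr_ge0// mulr_ge0// ltW.
have meg : measurable_fun setT (fun t => (g t)%:E) by exact/measurable_EFinP.
have meb : measurable_fun setT (fun t => (b t)%:E) by exact/measurable_EFinP.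
rewrite ge0_integralD//; last 4 first.
- by move=> t _; rewrite -EFinM -EFinD lee_fin (addr_ge0 e2)// mulr_ge0.
- by apply: emeasurable_funD => //; apply: measurable_funeM.
- by move=> t _; rewrite -EFinM lee_fin mulr_ge0.
- exact: measurable_funeM.
rewrite ge0_integralD//; last 2 first.
- by move=> t _; rewrite -EFinM lee_fin mulr_ge0.
- exact: measurable_funeM.
have momb : (\int[gauss m S]_t (b t)%:E <= (8 * c * n%:R)%:E)%E.
  by apply: gauss_sqnorm_moment => // i; rewrite trmx1 mul1mx mulmx1.
rewrite integral_gauss_cst// !ge0_integralZl_EFin//; last 2 first.
- by move=> t _; rewrite lee_fin.
- by move=> t _; rewrite lee_fin.
rewrite 2!EFinD; apply: leeD; first apply: leeD => //.
  rewrite [leRHS]EFinM muleC; apply: lee_wpmul2r => //.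
  by rewrite -qu; exact: gauss_expR_dispersion.
apply: (@le_trans _ _ ((2 * tau ^+ 2)^-1%:E * (8 * c * n%:R)%:E)%E).
  exact: lee_wpmul2l.
rewrite -EFinM lee_fin le_eqVlt; apply/orP; left; apply/eqP.
by field; rewrite gt_eqF.
Qed.

(** Makes the bound linear in v = m^T S m / tau^4, so that it can be averaged over the observation.
    For v <= 1, exp(2 v) - 1 <= 2 v exp(2); for v > 1 the right side exceeds 1, as [e] <= 1, and the
    trivial bound applies. *)
Lemma tv_dist_tilt n (m : 'cV[R]_n) S (tau e c a : R) P : posdef S ->
  0 < tau -> 0 < e <= 1 -> 0 < c -> (forall i, S i i <= c) -> 0 < a ->
  (forall B, measurable B -> P B =
    (a%:E * \int[gauss m S]_(t in B) (tilt tau m t)%:E) /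
    (a%:E * \int[gauss m S]_t (tilt tau m t)%:E))%E ->
  (tv_dist P (gauss m S) <= (2 * e + 4 * expR 2 / e * (quadf S m / tau ^+ 4)
       + 16 * c * n%:R / tau ^+ 2)%:E)%E.
Proof.
move=> Spos tau0 /andP[e0 e1] c0 Sc a0 PE.
have t2 : 0 < tau ^+ 2 by rewrite exprn_gt0.
have t4 : 0 < tau ^+ 4 by rewrite exprn_gt0.
have [tvD tv1] := tv_dist_reweight (gauss_setT m Spos)
  (fun t => expR_gt0 _) (@measurable_tilt n tau m) a0
  (gauss_tilt_deviation m Spos tau0 e0 c0 Sc) PE.
set v := quadf S m / tau ^+ 4 in tvD *.
have E1 : 1 <= expR 2 :> R by rewrite -expR0 ler_expR.
have b0 : 0 <= 16 * c * n%:R / tau ^+ 2.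
  by rewrite divr_ge0 ?(ltW t2)// !mulr_ge0// ltW.
have [v1|v1] := leP v 1; last first.
  apply: (le_trans tv1); rewrite lee_fin.
  have : 1 <= 4 * expR 2 / e * v.
    rewrite -[leLHS]mulr1 ler_pM// ?(ltW v1)//.
    by rewrite ler_pdivlMr// mul1r; apply: (le_trans e1); lra.
  by lra.
apply: (le_trans tvD); rewrite lee_fin.
have v0 : 0 <= v by rewrite divr_ge0 ?(ltW t4)// posdef_quadf_ge0.
have E2v : expR (2 * v) - 1 <= 2 * v * expR 2.
  have h : expR (2 * v) <= expR 2 by rewrite ler_expR; lra.
  apply: (@le_trans _ _ (2 * v * expR (2 * v))); last by apply: ler_wpM2l => //; lra.
  (* From 1 - x <= exp(-x) at x = 2 v, multiplied by exp(x). *)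
  have := expR_ge1Dx (- (2 * v)); have := expR_gt0 (2 * v); rewrite expRN => p.
  by rewrite -(ler_pM2r p) mulVf ?gt_eqF//; lra.
have -> : 4 * (e / 2 + (expR (2 * v) - 1) / (2 * e) + 4 * c * n%:R / tau ^+ 2) =
    2 * e + 2 / e * (expR (2 * v) - 1) + 16 * c * n%:R / tau ^+ 2.
  by field; rewrite !gt_eqF.
rewrite lerD2r lerD2l (_ : 4 * expR 2 / e * v = 2 / e * (2 * v * expR 2)); last by ring.
by rewrite ler_wpM2l// divr_ge0// ltW.
Qed.

End gaussian_weight.

(** * Least squares and the posterior *)

(* No measurability is needed because the integral of a nonnegative function is
   a supremum over simple functions; the total variation distance to a law
   that varies with the observation is not known to be measurable. *)
Lemma ge0_le_lower_integral d (T : measurableType d) (R : realType)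
    (mu : {measure set T -> \bar R}) (f g : T -> \bar R) :
  (forall t, 0 <= f t)%E -> (forall t, f t <= g t)%E ->
  (\int[mu]_t f t <= \int[mu]_t g t)%E.
Proof.
move=> f0 fg; have g0 t : (0 <= g t)%E by exact: le_trans (fg t).
rewrite !ge0_integralTE//; apply: le_ereal_sup => _ [h /= hf <-].
by exists h => // t; exact: le_trans (fg t).
Qed.

Lemma tv_dist_ge0 d (T : measurableType d) (R : realType)
  (P Q : set T -> \bar R) : (0 <= tv_dist P Q)%E.
Proof.
by apply: (@le_trans _ _ `|P set0 - Q set0|%E) => //; apply: ereal_sup_ubound; exists set0.
Qed.

Lemma posterior_ge0 d (T : measurableType d) (R : realType)
    (W : {measure set T -> \bar R}) (p : T -> R) A :
  (forall t, 0 <= p t) -> (0 <= posterior W p A)%E.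
Proof.
move=> p0; have I0 B : (0 <= \int[W]_(t in B) (p t)%:E)%E.
  by apply: integral_ge0 => t _; rewrite lee_fin.
by rewrite mule_ge0// inve_ge0.
Qed.

Section least_squares.
Context {R : realType}.
Variables (n k : nat) (Phi : 'M[R]_(n, k)) (sigma mu : R).
Hypotheses (sigma0 : 0 < sigma) (mu0 : 0 < mu).
Hypothesis Phi_lb : forall v, mu * dot v v <= dot (Phi *m v) (Phi *m v).

Let A := Phi^T *m Phi.
Let S := sigma ^+ 2 *: invmx A.

Lemma quadf_gram v : quadf A v = dot (Phi *m v) (Phi *m v).
Proof. by rewrite quadf_dot dot_mulmxl mulmxA. Qed.

Lemma posdef_gram : posdef A.
Proof.
split=> [|v v0]; first by rewrite trmx_mul trmxK.
by rewrite quadf_gram (lt_le_trans _ (Phi_lb v))// mulr_gt0// dot_gt0.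
Qed.

Let uA : A \in unitmx. Proof. exact: posdef_unit posdef_gram. Qed.

Let sigma2 : 0 < sigma ^+ 2. Proof. by rewrite exprn_gt0. Qed.

Lemma posdef_lse_cov : posdef S.
Proof. exact: posdefZ (posdef_inv posdef_gram). Qed.

(** An eigenvalue bound without diagonalization: z = A^-1 u satisfies mu |z|^2 <= <u, z>, and
    expanding |u - mu z|^2 >= 0 then gives mu <u, z> <= |u|^2. *)
Lemma quadf_gram_inv_le u : quadf (invmx A) u <= dot u u / mu.
Proof.
pose z := invmx A *m u.
have uz : dot u z = dot (Phi *m z) (Phi *m z).
  by rewrite -quadf_gram quadf_dot mulKVmx// dotC.
rewrite quadf_dot ler_pdivlMr// -/z.
have := dot_ge0 (u - mu *: z); have := Phi_lb z; rewrite -uz => lb.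
rewrite !(dotDl, dotDr, dotNl, dotNr, dotZl, dotZr) (dotC z u) => h.
have : mu * (mu * dot z z) <= mu * dot u z by rewrite ler_wpM2l// ltW.
lra.
Qed.

Lemma quadf_lse_cov_le u : quadf S u <= sigma ^+ 2 / mu * dot u u.
Proof.
rewrite quadf_dot -scalemxAl dotZr -quadf_dot -mulrA ler_wpM2l ?(ltW sigma2)//.
by rewrite mulrC; exact: quadf_gram_inv_le.
Qed.

Lemma lse_cov_diag_le i : S i i <= sigma ^+ 2 / mu.
Proof.
have -> : S i i = quadf S (delta_mx i 0).
  by rewrite /quadf trmx_delta -rowE -colE !mxE.
apply: le_trans (quadf_lse_cov_le _) _.
rewrite dotE (bigD1 i)//= big1 => [|j ji]; last by rewrite !mxE (negbTE ji) mul0r.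
by rewrite !mxE !eqxx mulr1 addr0 mulr1.
Qed.

Lemma lse_orthogonal y : Phi^T *m (y - Phi *m lse Phi y) = 0.
Proof.
have -> : lse Phi y = invmx A *m (Phi^T *m y) by rewrite mulmxA.
by rewrite mulmxBr [X in _ - X]mulmxA mulKVmx// subrr.
Qed.

(** Pythagoras: the least squares residual is orthogonal to the range of [Phi]. As a function of
    [v], the likelihood is therefore Gaussian around [lse Phi y] with precision A / sigma^2. *)
Lemma residual_decomp y v :
  dot (y - Phi *m v) (y - Phi *m v) =
  dot (y - Phi *m lse Phi y) (y - Phi *m lse Phi y) + quadf A (v - lse Phi y).
Proof.
have -> : y - Phi *m v = (y - Phi *m lse Phi y) - Phi *m (v - lse Phi y).
  by rewrite mulmxBr opprB addrA subrK.
have o : dot (Phi *m (v - lse Phi y)) (y - Phi *m lse Phi y) = 0.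
  by rewrite dot_mulmxl lse_orthogonal /dot mulmx0 mxE.
rewrite quadf_gram; move: o.
move: (y - _) (Phi *m (v - _)) => r p o.
by rewrite !(dotDl, dotDr, dotNl, dotNr) (dotC r p) o; ring.
Qed.

(** The fitted vector is a projection of [y], hence no longer than [y]; this is Pythagoras at [v] =
    0. *)
Lemma lse_sqnorm_le y : dot (lse Phi y) (lse Phi y) <= dot y y / mu.
Proof.
rewrite ler_pdivlMr// mulrC (le_trans (Phi_lb _))//.
have := residual_decomp y 0.
rewrite mulmx0 subr0 sub0r quadf_gram mulmxN dotNl dotNr opprK => ->.
by rewrite lerDr dot_ge0.
Qed.

Lemma lse_sub y z : lse Phi y - lse Phi z = invmx A *m Phi^T *m (y - z).
Proof. by rewrite mulmxBr. Qed.

(** The estimator fluctuates with the same covariance [S] as the Gaussian approximation, so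
    [lse_cov_diag_le] controls both. *)
Lemma lse_cov :
  (invmx A *m Phi^T) *m (sigma ^+ 2)%:M *m (invmx A *m Phi^T)^T = S.
Proof.
rewrite mul_mx_scalar -scalemxAl trmx_mul trmxK (posdef_inv posdef_gram).1.
by rewrite -mulmxA (mulmxA Phi^T) mulmxA mulVmx// mul1mx.
Qed.

Lemma lse_risk_le F : (\int[gauss F (sigma ^+ 2)%:M]_y
    (dot (lse Phi (colv y) - lse Phi F) (lse Phi (colv y) - lse Phi F))%:E
  <= (8 * (sigma ^+ 2 / mu) * k%:R)%:E)%E.
Proof.
under eq_integral do rewrite lse_sub.
apply: gauss_sqnorm_moment.
- exact: posdef_scalar.
- exact: divr_gt0.
- by move=> i; rewrite lse_cov lse_cov_diag_le.
Qed.

Lemma measurable_lse_sqdist F : measurable_fun setT (fun y : euclid R n =>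
  dot (lse Phi (colv y) - lse Phi F) (lse Phi (colv y) - lse Phi F)).
Proof.
rewrite (_ : (fun _ => _) = (fun y : euclid R n => \sum_i
   (invmx A *m Phi^T *m (colv y - F)) i 0 * (invmx A *m Phi^T *m (colv y - F)) i 0)).
  by apply: measurable_sum => i; apply: measurable_funM; exact: measurable_linear.
by apply/funext => y; rewrite dotE lse_sub.
Qed.

Variable tau : R.
Hypothesis tau0 : 0 < tau.

Let tau2 : 0 < tau ^+ 2. Proof. by rewrite exprn_gt0. Qed.

Lemma gauss_pdf_tilt y : exists2 a : R, 0 < a & forall t : euclid R k,
  gauss_pdf (Phi *m colv t) (sigma ^+ 2)%:M y *
    gauss_pdf 0 (tau ^+ 2)%:M (colv t) =
  a * (tilt tau (lse Phi y) t * gauss_pdf (lse Phi y) S (colv t)).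
Proof.
pose peak j (M : 'M[R]_j) := (Num.sqrt ((2 * pi) ^+ j * \det M))^-1.
have peak0 j (M : 'M[R]_j) : posdef M -> 0 < peak j M.
  move=> /posdef_det_gt0 M0; rewrite invr_gt0 sqrtr_gt0.
  by rewrite mulr_gt0// exprn_gt0// mulr_gt0// pi_gt0.
pose r := y - Phi *m lse Phi y; pose m := lse Phi y.
have pS := peak0 _ _ posdef_lse_cov.
have pn := peak0 _ _ (posdef_scalar n sigma2).
have pk := peak0 _ _ (posdef_scalar k tau2).
(* The factor gathers the normalizing constants, the residual term of the likelihood, and the term
   in |m|^2 that compensates for [tilt] being 1 at m. *)
exists (peak n (sigma ^+ 2)%:M * peak k (tau ^+ 2)%:M / peak k S *
    expR (- (dot r r / sigma ^+ 2 + dot m m / tau ^+ 2) / 2)).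
  by rewrite mulr_gt0 ?expR_gt0// divr_gt0// mulr_gt0.
have pdfE j v (M : 'M[R]_j) z :
  gauss_pdf v M z = peak j M * expR (- quadf (invmx M) (z - v) / 2) by [].
move=> t; rewrite !pdfE !invmx_scalar /tilt -/m invmxZ ?invmxK; last first.
  by rewrite unitmxZ ?unitfE ?gt_eqF// unitmx_inv.
have scal j (c : R) (v : 'cV[R]_j) : quadf c%:M v = c * dot v v.
  by rewrite quadf_dot mul_scalar_mx dotZr.
have -> : quadf ((sigma ^+ 2)^-1 *: A) (colv t - m) =
    (sigma ^+ 2)^-1 * quadf A (colv t - m).
  by rewrite !quadf_dot -scalemxAl dotZr.
rewrite !scal subr0 residual_decomp -/r -/m.
set E1 := expR _; set E2 := expR _; set E3 := expR _; set E4 := expR _; set E5 := expR _.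
have EE : E1 * E2 = E3 * (E4 * E5).
  by rewrite -!expRD; congr expR; field; rewrite !gt_eqF.
rewrite [LHS]mulrACA EE; field.
by rewrite gt_eqF.
Qed.

Let quadf_scalar j (c : R) (v : 'cV[R]_j) : quadf c%:M v = c * dot v v.
Proof. by rewrite quadf_dot mul_scalar_mx dotZr. Qed.

Lemma measurable_likelihood y : measurable_fun setT (fun t : euclid R k =>
  gauss_pdf (Phi *m colv t) (sigma ^+ 2)%:M y).
Proof.
under eq_fun do rewrite gauss_pdfE invmx_scalar quadf_scalar residual_decomp.
apply: measurable_funM => //; apply: measurableT_comp => //.
apply: measurable_funM => //; apply: measurableT_comp => //.
apply: measurable_funM => //; apply: measurable_funD => //.
exact: measurable_quadf.
Qed.

Lemma regression_posterior_tilt (y : euclid R n) : exists2 a : R, 0 < a &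
  forall B, measurable B ->
  regression_posterior Phi sigma (gauss 0 (tau ^+ 2)%:M) y B =
  ((a%:E * \int[gauss (lse Phi (colv y)) S]_(t in B) (tilt tau (lse Phi (colv y)) t)%:E) /
   (a%:E * \int[gauss (lse Phi (colv y)) S]_t (tilt tau (lse Phi (colv y)) t)%:E))%E.
Proof.
have [a a0 aE] := gauss_pdf_tilt (colv y).
exists a => // B mB.
(* One identity serves twice: with [B] in the numerator of Bayes' formula and with the whole space
   in the denominator. *)
suff H D : measurable D -> (\int[gauss 0 (tau ^+ 2)%:M]_(t in D)
     (gauss_pdf (Phi *m colv t) (sigma ^+ 2)%:M (colv y))%:E =
   a%:E * \int[gauss (lse Phi (colv y)) S]_(t in D)
     (tilt tau (lse Phi (colv y)) t)%:E)%E.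
  exact: (congr2 (fun u v => u / v)%E (H _ mB) (H _ measurableT)).
move=> mD; have mt := @measurable_tilt R k tau (lse Phi (colv y)).
apply: (etrans (ge0_integral_gauss _ _ mD _ _)).
- by move=> t; rewrite lee_fin gauss_pdf_ge0.
- by apply/measurable_EFinP; exact: measurable_likelihood.
apply: (@etrans _ _ (a%:E * \int[lebesgue_euclid k]_(t in D)
    ((tilt tau (lse Phi (colv y)) t)%:E *
     (gauss_pdf (lse Phi (colv y)) S (colv t))%:E))%E); last first.
  congr (_ * _)%E; apply/esym; apply: ge0_integral_gauss => //.
    by move=> t; rewrite lee_fin expR_ge0.
  exact/measurable_EFinP.
rewrite -ge0_integralZl//.
- by apply: eq_integral => t _; rewrite -!EFinM aE.
- apply/measurable_funTS/measurable_EFinP/measurable_funM => //.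
  exact: measurable_gauss_pdf.
- by move=> t _; rewrite -EFinM lee_fin mulr_ge0 ?expR_ge0 ?gauss_pdf_ge0.
- by rewrite lee_fin ltW.
Qed.

(** * Averaging over the observation *)

Variable F : 'cV[R]_n.
Variable e : R.
Hypothesis e01 : 0 < e <= 1.

(** Given the observation, the total variation bound will be K + b G, affine in the squared error
    [G] of the least squares estimator; [c] bounds the diagonal of [S]. *)
Let c := sigma ^+ 2 / mu.
Let G (y : euclid R n) :=
  dot (lse Phi (colv y) - lse Phi F) (lse Phi (colv y) - lse Phi F).
Let b := 8 * expR 2 / e * (c / tau ^+ 4).
Let K := 2 * e + b * dot (lse Phi F) (lse Phi F) + 16 * c * k%:R / tau ^+ 2.

Let e0 : 0 < e. Proof. by case/andP: e01. Qed.
Let c0 : 0 < c. Proof. exact: divr_gt0. Qed.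
Let b0 : 0 <= b.
Proof. by rewrite mulr_ge0 ?divr_ge0 ?mulr_ge0 ?expR_ge0 ?exprn_ge0// ltW. Qed.
Let G0 y : 0 <= G y. Proof. exact: dot_ge0. Qed.
Let K0 : 0 <= K.
Proof.
have h1 : 0 <= b * dot (lse Phi F) (lse Phi F) by rewrite mulr_ge0// dot_ge0.
have h2 : 0 <= 16 * c * k%:R / tau ^+ 2.
  by apply: divr_ge0 (ltW tau2); apply: mulr_ge0 => //; apply: mulr_ge0 (ltW c0).
by rewrite /K; move: e0; lra.
Qed.

Lemma tv_dist_posterior_le y :
  (tv_dist (regression_posterior Phi sigma (gauss 0 (tau ^+ 2)%:M) y)
     (gauss (lse Phi (colv y)) S) <= K%:E + b%:E * (G y)%:E)%E.
Proof.
have [a a0 aE] := regression_posterior_tilt y.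
apply: le_trans (tv_dist_tilt posdef_lse_cov tau0 e01 c0 lse_cov_diag_le a0 aE) _.
rewrite -EFinM -EFinD lee_fin /K [leRHS]addrAC lerD2r -[leRHS]addrA lerD2l -mulrDr.
(* Writing the estimator as theta_0 plus its error bounds its squared norm by 2 |theta_0|^2 + 2 G,
   which turns the 4 of [tv_dist_tilt] into the 8 of [b]. *)
have qle : quadf S (lse Phi (colv y)) <=
    c * (2 * dot (lse Phi F) (lse Phi F) + 2 * G y).
  apply: le_trans (quadf_lse_cov_le _) _; rewrite ler_wpM2l ?(ltW c0)//.
  rewrite -{1 2}(subrK (lse Phi F) (lse Phi (colv y))).
  by rewrite addrC (le_trans (dot_sqD_le _ _)).
have -> : b * (dot (lse Phi F) (lse Phi F) + G y) = 4 * expR 2 / e *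
   (c * (2 * dot (lse Phi F) (lse Phi F) + 2 * G y) / tau ^+ 4).
  by rewrite /b; field; rewrite !gt_eqF.
apply: ler_wpM2l; first by rewrite divr_ge0 ?(ltW e0)// mulr_ge0// expR_ge0.
by rewrite ler_wpM2r// invr_ge0 exprn_ge0// ltW.
Qed.

Let mG : measurable_fun setT (fun y => (G y)%:E).
Proof. by apply/measurable_EFinP; exact: measurable_lse_sqdist. Qed.

Let integral_affine_le (u v : R) : 0 <= u -> 0 <= v ->
  (\int[gauss F (sigma ^+ 2)%:M]_y (u%:E + v%:E * (G y)%:E) <=
   (u + v * (8 * c * k%:R))%:E)%E.
Proof.
move=> u0 v0; rewrite ge0_integralD//; last 2 first.
- by move=> y _; rewrite -EFinM lee_fin mulr_ge0.
- exact: measurable_funeM.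
rewrite integral_gauss_cst; last exact: posdef_scalar.
rewrite ge0_integralZl_EFin//; last by move=> y _; rewrite lee_fin.
rewrite EFinD EFinM; apply: leeD2l; apply: lee_wpmul2l; first by rewrite lee_fin.
exact: lse_risk_le.
Qed.

Lemma expected_tv_dist_posterior_le :
  (\int[gauss F (sigma ^+ 2)%:M]_y
     tv_dist (regression_posterior Phi sigma (gauss 0 (tau ^+ 2)%:M) y)
       (gauss (lse Phi (colv y)) S) <= (K + b * (8 * c * k%:R))%:E)%E.
Proof.
apply: (le_trans _ (integral_affine_le K0 b0)).
apply: ge0_le_lower_integral => y; first exact: tv_dist_ge0.
exact: tv_dist_posterior_le.
Qed.

Lemma measurable_enorm_ge (r : R) (m : 'cV[R]_k) :
  measurable [set t : euclid R k | r <= enorm (colv t - m)].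
Proof.
have mE : measurable_fun setT (fun t : euclid R k => enorm (colv t - m)).
  apply: measurableT_comp.
    by apply: continuous_measurable_fun; exact: sqrt_continuous.
  by apply: measurable_sum => i; apply: measurable_funX; exact: measurable_coord.
rewrite -[X in measurable X]setTI.
rewrite (_ : [set t | _] = (fun t : euclid R k => enorm (colv t - m)) @^-1` `[r, +oo[).
  exact: mE.
by apply/seteqP; split => t /=; rewrite in_itv/= andbT.
Qed.

(** Markov's inequality, with |t - theta_0|^2 <= 2 |m - theta_0|^2 + 2 |t - m|^2, the last term
    having mean at most 16 c k. *)
Lemma gauss_far_le (m : 'cV[R]_k) (r : R) : 0 < r ->
  (gauss m S [set t : euclid R k | (r <= enorm (colv t - lse Phi F))%R] <=
   ((16 * c * k%:R + 2 * dot (m - lse Phi F) (m - lse Phi F)) / r ^+ 2)%:E)%E.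
Proof.
move=> r0; set B := [set t | _]; set D := dot (m - _) _.
have mB : measurable B by exact: measurable_enorm_ge.
have r2 : 0 < r ^+ 2 by rewrite exprn_gt0.
have D0 : 0 <= D by exact: dot_ge0.
pose h (t : euclid R k) := dot (1%:M *m (colv t - m)) (1%:M *m (colv t - m)).
have h0 t : 0 <= h t by exact: dot_ge0.
have mh : measurable_fun setT (fun t => (h t)%:E).
  apply/measurable_EFinP; rewrite (_ : h = fun t : euclid R k => quadf 1%:M (colv t - m)).
    exact: measurable_quadf.
  by apply/funext => t; rewrite /h quadf_dot mul1mx.
have momh : (\int[gauss m S]_t (h t)%:E <= (8 * c * k%:R)%:E)%E.
  apply: gauss_sqnorm_moment => //; first exact: posdef_lse_cov.
  by move=> i; rewrite trmx1 mul1mx mulmx1 lse_cov_diag_le.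
pose g t := ((2 * D / r ^+ 2)%:E + (2 / r ^+ 2)%:E * (h t)%:E)%E.
have g0 t : (0 <= g t)%E.
  by rewrite /g -EFinM -EFinD lee_fin addr_ge0 ?mulr_ge0 ?invr_ge0// ltW.
have mg : measurable_fun setT g.
  by apply: emeasurable_funD => //; exact: measurable_funeM.
apply: (@le_trans _ _ (\int[gauss m S]_t g t)%E).
  have -> : gauss m S B = (\int[gauss m S]_(t in B) 1%:E)%E.
    by rewrite integral_cst//= mul1e.
  apply: (@le_trans _ _ (\int[gauss m S]_(t in B) g t)%E).
    apply: ge0_le_integral => //; first exact: measurable_funTS.
    move=> t; rewrite /B/= => rt; rewrite /g -EFinM -EFinD lee_fin.
    rewrite [leRHS](_ : _ = (2 * D + 2 * h t) / r ^+ 2); last first.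
      by field; rewrite gt_eqF.
    rewrite ler_pdivlMr// mul1r.
    apply: (@le_trans _ _ (enorm (colv t - lse Phi F) ^+ 2)).
      by rewrite ler_pXn2r// ?nnegrE ?(ltW r0)// sqrtr_ge0.
    rewrite enorm_sqr /h mul1mx.
    rewrite (_ : colv t - lse Phi F = (m - lse Phi F) + (colv t - m)).
      exact: dot_sqD_le.
    by rewrite [RHS]addrC [RHS]addrA subrK.
  by apply: ge0_subset_integral.
rewrite /g ge0_integralD//; last 3 first.
- by move=> t _; rewrite lee_fin mulr_ge0 ?invr_ge0 ?mulr_ge0// ltW.
- by move=> t _; rewrite -EFinM lee_fin mulr_ge0// divr_ge0// ltW.
- exact: measurable_funeM.
rewrite integral_gauss_cst; last exact: posdef_lse_cov.
rewrite ge0_integralZl_EFin//; last 2 first.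
- by move=> t _; rewrite lee_fin.
- by rewrite divr_ge0// ltW.
apply: (@le_trans _ _ ((2 * D / r ^+ 2)%:E + (2 / r ^+ 2)%:E * (8 * c * k%:R)%:E)%E).
  by apply: leeD2l; apply: lee_wpmul2l => //; rewrite lee_fin divr_ge0// ltW.
rewrite -EFinM -EFinD lee_fin le_eqVlt; apply/orP; left; apply/eqP.
by field; rewrite gt_eqF.
Qed.

(** The posterior probability is at most that under the Gaussian approximation plus the total
    variation distance, and both bounds are affine in [G]. The constant is 32 = 16 + 2 * 8, the
    second part coming from the risk 8 c k. *)
Lemma expected_posterior_far_le (r : R) : 0 < r ->
  (\int[gauss F (sigma ^+ 2)%:M]_y
     regression_posterior Phi sigma (gauss 0 (tau ^+ 2)%:M) y
       [set t : euclid R k | (r <= enorm (colv t - lse Phi F))%R]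
   <= (K + b * (8 * c * k%:R) + 32 * c * k%:R / r ^+ 2)%:E)%E.
Proof.
move=> r0; have r2 : 0 < r ^+ 2 by rewrite exprn_gt0.
set B := [set t | _]; have mB : measurable B by exact: measurable_enorm_ge.
have -> : K + b * (8 * c * k%:R) + 32 * c * k%:R / r ^+ 2 =
    (K + 16 * c * k%:R / r ^+ 2) + (b + 2 / r ^+ 2) * (8 * c * k%:R).
  by field; rewrite gt_eqF.
apply: (le_trans _ (integral_affine_le _ _)); last 2 first.
- apply: addr_ge0 => //; apply: divr_ge0 (ltW r2); apply: mulr_ge0 => //.
  exact: mulr_ge0 (ltW c0).
- by rewrite addr_ge0// divr_ge0// ltW.
apply: ge0_le_lower_integral => y.
  by apply: posterior_ge0 => t; exact: gauss_pdf_ge0.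
apply: (le_trans (tv_dist_upper (gauss_setT _ posdef_lse_cov) _ mB)).
apply: (le_trans (leeD (gauss_far_le _ r0) (tv_dist_posterior_le y))).
rewrite -/(G y) -!EFinM -!EFinD lee_fin le_eqVlt; apply/orP; left; apply/eqP.
by field; rewrite gt_eqF.
Qed.

End least_squares.

(** * Rates *)

Section rates.
Context {R : realType}.

(** First [e] is fixed so that 2 e <= d / 2, then [h], depending on [e], so that the other terms,
    each at most a constant times [h], add up to at most d / 2. Here [th] stands for |theta_0|^2. *)
Lemma rate_budget (C1 B s d : R) : 0 < C1 -> 0 < s -> 0 < d ->
  exists e h : R, [/\ 0 < e <= 1, 0 < h & forall n k tau th c b : R,
    1 <= n -> 1 <= k -> 0 < tau ->
    k ^+ 2 / n <= h * tau ^+ 2 -> k ^+ 3 / n <= h * tau ^+ 4 ->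
    th <= k * B ^+ 2 / C1 ->
    c = s ^+ 2 / (C1 * (n / k)) ->
    b = 8 * expR 2 / e * (c / tau ^+ 4) ->
    2 * e + b * th + 16 * c * k / tau ^+ 2 + b * (8 * c * k) <= d].
Proof.
move=> C10 s0 d0.
pose e := Num.min 1 (d / 4); pose P := s ^+ 2 / C1.
have e0 : 0 < e by rewrite lt_min ltr01 divr_gt0.
have e1 : e <= 1 by rewrite ge_min lexx.
have ed : 2 * e <= d / 2.
  have : e <= d / 4 by rewrite ge_min lexx orbT.
  lra.
have P0 : 0 < P by rewrite divr_gt0// exprn_gt0.
pose L := 8 * expR 2 / e * P.
have L0 : 0 < L by rewrite mulr_gt0// divr_gt0// mulr_gt0// expR_gt0.
pose M := B ^+ 2 / C1 + 8 * P.
have M0 : 0 < M.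
  by rewrite ltr_wpDl ?divr_ge0 ?sqr_ge0 ?(ltW C10)// mulr_gt0.
pose W := 16 * P + L * M.
have W0 : 0 < W by rewrite addr_gt0// mulr_gt0.
exists e, (d / 2 / W); split=> //.
- by rewrite e0.
- by rewrite !divr_gt0.
move=> n k tau th c b n1 k1 tau0 h2 h4 hth cdef bE.
have n0 : 0 < n by lra.
have k0 : 0 < k by lra.
have t2 : 0 < tau ^+ 2 by rewrite exprn_gt0.
have t4 : 0 < tau ^+ 4 by rewrite exprn_gt0.
set h := d / 2 / W in h2 h4.
have cE : c = P * (k / n) by rewrite cdef /P; field; rewrite !gt_eqF.
have q2 : 16 * c * k / tau ^+ 2 <= 16 * P * h.
  rewrite (_ : _ / _ = 16 * P * (k ^+ 2 / n / tau ^+ 2)); last first.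
    by rewrite cE; field; rewrite !gt_eqF.
  apply: ler_wpM2l; first by rewrite mulr_ge0// ltW.
  by rewrite ler_pdivrMr.
have b0 : 0 <= b.
  rewrite bE cE !(mulr_ge0, divr_ge0, invr_ge0, expR_ge0)// ltW//.
(* Since [k] and [n] are at least 1, [th] and 8 c k are both at most constants times k^2, while [b]
   brings the factor k / (n tau^4). *)
have q4 : b * (th + 8 * c * k) <= L * M * h.
  apply: (@le_trans _ _ (b * (k ^+ 2 * M))).
    apply: ler_wpM2l => //; rewrite /M mulrDr; apply: lerD.
      apply: (le_trans hth); rewrite mulrA ler_pM2r ?invr_gt0//.
      rewrite ler_wpM2r ?sqr_ge0// expr2 ler_peMl// ltW//.
    rewrite (_ : 8 * c * k = k ^+ 2 * (8 * P) / n); last first.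
      by rewrite cE; field; rewrite gt_eqF.
    rewrite ler_pdivrMr// ler_peMr// mulr_ge0 ?sqr_ge0// mulr_ge0// ltW//.
  rewrite (_ : b * _ = L * M * (k ^+ 3 / n / tau ^+ 4)); last first.
    by rewrite bE /L cE; field; rewrite !gt_eqF.
  apply: ler_wpM2l; first by rewrite mulr_ge0// ltW.
  by rewrite ler_pdivrMr.
have Wh : W * h = d / 2 by rewrite /h; field; rewrite gt_eqF.
by rewrite /W in Wh; lra.
Qed.

Lemma cvge0_ub (u : (\bar R)^nat) : (forall n, (0 <= u n)%E) ->
  (forall d : R, 0 < d -> \forall n \near \oo, (u n <= d%:E)%E) ->
  u @ \oo --> 0%E.
Proof.
move=> u0 ud; apply/fine_cvgP; split.
  near=> n; rewrite ge0_fin_numE//; apply: (@le_lt_trans _ _ 1%:E); last exact: ltry.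
  by near: n; exact: ud.
apply/cvgr0Pnorm_le => d d0; near=> n.
have : (u n <= d%:E)%E by near: n; exact: ud.
by have := u0 n; rewrite /=; case: (u n) => [r| |]//=; rewrite !lee_fin => r0; rewrite ger0_norm.
Unshelve. all: by end_near. Qed.

(** Once n >= e, the logarithm is at least 1, so removing it only decreases the left side. *)
Lemma littleo_ln_le (g t : nat -> R) d : 0 < d -> (forall n, 0 <= g n) ->
  (forall n, 0 <= t n) ->
  (fun n => (g n * ln n%:R / n%:R : R^o)) =o_\oo (fun n => (t n : R^o)) ->
  \forall n \near \oo, g n / n%:R <= d * t n.
Proof.
move=> d0 g0 t0 /eqoP/(_ _ d0) go; near=> n.
have n1 : 1 <= ln (n%:R : R).
  rewrite -[leLHS]expRK ler_ln ?posrE ?expR_gt0//.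
    by near: n; exact: nbhs_infty_ger.
  by rewrite ltr0n; near: n; exact: nbhs_infty_gt.
have : `|g n * ln n%:R / n%:R : R| <= d * `|t n : R| by near: n.
rewrite (ger0_norm (t0 n)) => /(le_trans (ler_norm _)); apply: le_trans.
by rewrite mulrAC ler_peMr// divr_ge0.
Unshelve. all: by end_near. Qed.

End rates.

Theorem proposition8 (R : realType) (alpha : R) (f : R -> R)
    (x : forall n : nat, 'I_n -> R) (sigma : R) (q : nat) (k : nat -> nat)
    (C1 C2 : R) (tau : nat -> R) :
  let F0 n : 'cV[R]_n := \col_i f (x n i) in
  let Phi n : 'M[R]_(n, k n) := bspline_design q (k n) (x n) in
  let prior n := gauss (0 : 'cV[R]_(k n)) (tau n ^+ 2)%:M in
  let law_Y n := gauss (F0 n) (sigma ^+ 2)%:M in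
  let post n := regression_posterior (Phi n) sigma (prior n) in
  0 < alpha ->
  holder_class alpha f ->
  (forall n i, x n i \in `[0, 1]) ->
  0 < sigma ->
  alpha <= q%:R ->
  (\forall n \near \oo,
    [/\ (q <= k n)%N, (k n <= n)%N & \rank (Phi n) = k n]) ->
  [bounded f t | t in `[0, 1]] ->
  0 < C1 -> 0 < C2 ->
  (\forall n \near \oo, forall theta : 'cV[R]_(k n),
    C1 * (n%:R / (k n)%:R) * enorm theta ^+ 2
      <= (theta^T *m (Phi n)^T *m Phi n *m theta) 0 0
      <= C2 * (n%:R / (k n)%:R) * enorm theta ^+ 2) ->
  (forall n, 0 < tau n) ->
  (fun n => ((k n)%:R ^+ 2 * ln n%:R / n%:R : R^o)) =o_\oo
    (fun n => (tau n ^+ 2 : R^o)) ->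
  (fun n => ((k n)%:R ^+ 3 * ln n%:R / n%:R : R^o)) =o_\oo
    (fun n => (tau n ^+ 4 : R^o)) ->
  ((\int[law_Y n]_y
      tv_dist (post n y)
        (gauss (lse (Phi n) (colv y))
               (sigma ^+ 2 *: invmx ((Phi n)^T *m Phi n))))%E
    @[n --> \oo] --> 0%E) /\
  (forall lambda : nat -> R, lambda @ \oo --> +oo ->
    (\int[law_Y n]_y
       post n y [set theta : euclid R (k n) |
         (lambda n * ((k n)%:R / Num.sqrt n%:R)
            <= enorm (colv theta - lse (Phi n) (F0 n)))%R])%E
    @[n --> \oo] --> 0%E).
Proof.
move=> F0 Phi prior law_Y post alpha0 _ x01 sigma0 alphaq dims fB C10 _ gramB tau0 o2 o4.
have [B B0 Bf] : exists2 B : R, 0 < B & forall t, t \in `[0, 1] -> `|f t| <= B.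
  have [B B0 Bf] := pinfty_ex_gt0 fB.
  by exists B => // t t01; exact: Bf.
(* As [q] is positive, so is [k n] for large [n], and the divisions by it are genuine. *)
have q0 : (0 < q)%N by rewrite -(ltr0n R); exact: lt_le_trans alphaq.
pose mu n := C1 * (n%:R / (k n)%:R).
pose th n := lse (Phi n) (F0 n).
have good (h : R) : 0 < h -> \forall n \near \oo,
   [/\ (0 < n)%N, (0 < k n)%N,
       (forall v, mu n * dot v v <= dot (Phi n *m v) (Phi n *m v)),
       (k n)%:R ^+ 2 / n%:R <= h * tau n ^+ 2 &
       (k n)%:R ^+ 3 / n%:R <= h * tau n ^+ 4].
  move=> h0; near=> n; split.
  - by near: n; exact: nbhs_infty_gt.
  - have [qk _ _] : [/\ (q <= k n)%N, (k n <= n)%N & \rank (Phi n) = k n] by near: n.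
    exact: leq_trans qk.
  - move=> v.
    have /andP[lb _] : C1 * (n%:R / (k n)%:R) * enorm v ^+ 2
      <= (v^T *m (Phi n)^T *m Phi n *m v) 0 0
      <= C2 * (n%:R / (k n)%:R) * enorm v ^+ 2.
      by move: v; near: n.
    by move: lb; rewrite enorm_sqr /dot trmx_mul !mulmxA.
  - near: n; apply: (littleo_ln_le h0 _ _ o2) => n; first exact: exprn_ge0.
    by rewrite exprn_ge0// ltW.
  - near: n; apply: (littleo_ln_le h0 _ _ o4) => n; first exact: exprn_ge0.
    by rewrite exprn_ge0// ltW.
have mu0 n : (0 < n)%N -> (0 < k n)%N -> 0 < mu n.
  by move=> n0 k0; rewrite mulr_gt0// divr_gt0// ltr0n.
(* |theta_0|^2 <= |F_0|^2 / mu <= n B^2 / mu, and mu = C1 n / k. *)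
have th_le n : (0 < n)%N -> (0 < k n)%N ->
    (forall v, mu n * dot v v <= dot (Phi n *m v) (Phi n *m v)) ->
    dot (th n) (th n) <= (k n)%:R * B ^+ 2 / C1.
  move=> n0 k0 lb; apply: (le_trans (lse_sqnorm_le (mu0 _ n0 k0) lb _)).
  rewrite ler_pdivrMr ?mu0// (_ : _ * mu n = n%:R * B ^+ 2); last first.
    by rewrite /mu; field; rewrite pnatr_eq0 -lt0n k0 gt_eqF.
  rewrite dotE mulr_natl -[in leRHS](card_ord n) -sumr_const; apply: ler_sum => i _.
  rewrite mxE -expr2 -[leLHS]real_normK ?num_real//.
  by rewrite ler_pXn2r ?nnegrE ?(ltW B0)//; exact: Bf.
split.
- apply: cvge0_ub => [n|d d0].
    by apply: integral_ge0 => y _; exact: tv_dist_ge0.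
  have [e [h [e01 h0 budget]]] := rate_budget B C10 sigma0 d0.
  have := good h h0; apply: filterS => n [n0 k0 lb h2 h4].
  apply: le_trans (expected_tv_dist_posterior_le sigma0 (mu0 _ n0 k0) lb (tau0 n) (F0 n) e01) _.
  by rewrite lee_fin; apply: (budget n%:R (k n)%:R); rewrite ?ler1n// th_le.
move=> lambda lambday; apply: cvge0_ub => [n|d d0].
  by apply: integral_ge0 => y _; apply: posterior_ge0 => t; exact: gauss_pdf_ge0.
(* Half of [d] goes to the total variation part, the other half to the Markov term. *)
have d2 : 0 < d / 2 by rewrite divr_gt0.
have [e [h [e01 h0 budget]]] := rate_budget B C10 sigma0 d2.
(* The Markov term is 32 sigma^2 / (C1 lambda^2); it is at most d / 2 once lambda >= max(1, M),
   since then lambda^2 >= lambda >= M. *)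
pose M := 32 * sigma ^+ 2 / C1 / (d / 2).
have M0 : 0 < M by rewrite !divr_gt0 ?mulr_gt0 ?exprn_gt0.
near=> n.
have [n0 k0 lb h2 h4] : [/\ (0 < n)%N, (0 < k n)%N,
       (forall v, mu n * dot v v <= dot (Phi n *m v) (Phi n *m v)),
       (k n)%:R ^+ 2 / n%:R <= h * tau n ^+ 2 &
       (k n)%:R ^+ 3 / n%:R <= h * tau n ^+ 4] by near: n; exact: good.
have lM : Num.max 1 M <= lambda n.
  by near: n; exact: (cvgryPge _).1 lambday _.
have l1 : 1 <= lambda n by apply: le_trans lM; rewrite le_max lexx.
have {}lM : M <= lambda n by apply: le_trans lM; rewrite le_max lexx orbT.
have l0 : 0 < lambda n by lra.
have nR : 0 < n%:R :> R by rewrite ltr0n.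
have kR : 0 < (k n)%:R :> R by rewrite ltr0n.
pose r := lambda n * ((k n)%:R / Num.sqrt n%:R).
have r0 : 0 < r by rewrite mulr_gt0// divr_gt0// sqrtr_gt0.
have r2 : r ^+ 2 = lambda n ^+ 2 * ((k n)%:R ^+ 2 / n%:R).
  by rewrite exprMn expr_div_n sqr_sqrtr// ltW.
apply: le_trans (expected_posterior_far_le sigma0 (mu0 _ n0 k0) lb (tau0 n) (F0 n) e01 r0) _.
rewrite lee_fin [leRHS]splitr.
apply: lerD; first by apply: (budget n%:R (k n)%:R); rewrite ?ler1n// th_le.
rewrite r2 /mu [leLHS](_ : _ = 32 * sigma ^+ 2 / C1 / lambda n ^+ 2); last first.
  by field; rewrite !gt_eqF.
rewrite ler_pdivrMr ?exprn_gt0// [leRHS]mulrC -ler_pdivrMr// -/M.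
by apply: (le_trans lM); rewrite expr2 ler_peMl// ltW.
Unshelve. all: by end_near. Qed.
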